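(* Let $r\ge1$ and let $T_{r,t}(x)\in\mathrm{End}(\mathbb C^{2r})^{\otimes N}$, $t\in\mathbb C$, be the analytically continued $C_r$-type transfer matrices. Then for any $t\in\mathbb C$, $$T_{r,t}(x)=(-1)^{\frac{r(r+1)}2}\,T_{r,-r-1-t}(x).$$
   Context: $e_{ij}$ are matrix units, $\mathrm I_m$ the identity matrix, $N\ge0$ a fixed integer, $i'=2r+1-i$. Twist parameters: $\tau_i=e^{x_i}$, $\tau_i^s:=e^{sx_i}$, $1\le i\le r$, with $|\tau_1|>\dots>|\tau_r|>1$ (so that the traces below converge). Let $\mathcal A$ be the algebra generated by $\mathbf a_{j',i},\bar{\mathbf a}_{i,j'}$, $1\le i\le j\le r$, with $[\mathbf a_{j',i},\bar{\mathbf a}_{k,\ell'}]=\delta_{ik}\delta_{j\ell}$ and all other commutators of generators zero; its Fock module $\mathsf F$ has basis the monomials in the $\bar{\mathbf a}_{i,j'}$ applied to $|0\rangle$, $\mathbf a_{j',i}|0\rangle=0$. $\bar{\mathbf A}$ is the $r\times r$ matrix with rows $i=1,\dots,r$ and columns labelled $r',(r-1)',\dots,1'$ left to right, with $(i,j')$ entry $\bar{\mathbf a}_{i,j'}$ if $i<j$, $2\bar{\mathbf a}_{i,i'}$ if $i=j$, $\bar{\mathbf a}_{j,i'}$ if $i>j$. $\mathbf A$ has rows labelled $r',\dots,1'$ top to bottom and columns $1,\dots,r$, with $(j',i)$ entry $\mathbf a_{j',i}$ if $i\le j$, $\mathbf a_{i',j}$ if $i>j$. For $t\in\mathbb C$,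 $$\mathcal L(x)=\begin{pmatrix}(x+t)\mathrm I_r-\bar{\mathbf A}\mathbf A&-\bar{\mathbf A}(2t+r+1-\mathbf A\bar{\mathbf A})\\-\mathbf A&(x-t-r-1)\mathrm I_r+\mathbf A\bar{\mathbf A}\end{pmatrix}.$$ $B_i=e_{ii'}-e_{i'i}+\sum_{j\le r,j\ne i}(e_{jj}+e_{j'j'})$, $B_{\vec\mu}=\prod_{j:\mu_j=-1}B_j$ for $\vec\mu\in\{\pm1\}^r$. $\mathcal L_{\vec\mu}(x)$ is $B_{\vec\mu}\mathcal L(x)B_{\vec\mu}^{-1}$ with the automorphism $\bar{\mathbf a}_{i,j'}\mapsto-\mathbf a_{j',i}$, $\mathbf a_{j',i}\mapsto\bar{\mathbf a}_{i,j'}$ applied for those $i\le j$ with $\mu_i=-1$. Write $\mathcal L_{\vec\mu}(x)=x\mathrm I_{2r}+\sum_{i,j}e_{ij}\mathcal F^{\vec\mu}_{ji}$ and $$T^+_{\vec\mu,t}(x)=\mathrm{tr}_{\mathsf F}\prod_{i=1}^r\tau_i^{\mathcal F^{\vec\mu}_{ii}}\,\underbrace{\mathcal L_{\vec\mu}(x)\otimes\cdots\otimes\mathcal L_{\vec\mu}(x)}_N,$$ where $\otimes$ is the tensor product in the matrix space and multiplication in $\mathcal A$, i.e. $L\otimes\cdots\otimes L=\sum e_{i_1j_1}\otimes\cdots\otimes e_{i_Nj_N}L_{i_1j_1}\cdots L_{i_Nj_N}$. With $\mathsf l(\vec\mu)=\sum_{i:\mu_i=-1}(r-i+1)$, the analytically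 continued transfer matrix is $T_{r,t}(x)=\sum_{\vec\mu\in\{\pm1\}^r}(-1)^{\mathsf l(\vec\mu)}T^+_{\vec\mu,t}(x)$ for all $t\in\mathbb C$. (For $t\in\mathbb N$ it equals the transfer matrix with trace over the irreducible finite-dimensional $\mathfrak{sp}_{2r}$-module $L_{t\omega_r}$.) *)

(* Defs.v *)
From HB Require Import structures.
From mathcomp Require Import all_boot all_order all_algebra complex mxtens.
From mathcomp Require Import all_classical all_reals all_analysis summability.
(* The notations of mpoly clash with those of mathcomp-analysis. *)
From mathcomp Require Import -(notations) mpoly.

Set Implicit Arguments.
Unset Strict Implicit.
Unset Printing Implicit Defensive.

Import Order.TTheory GRing.Theory Num.Theory numFieldNormedType.Exports.

Local Open Scope ring_scope.
Local Open Scope complex_scope.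

Definition cexp (R : realType) (z : R[i]) : R[i] :=
  (expR (complex.Re z))%:C
  * (cos (complex.Im z) +i* sin (complex.Im z)).

(* One oscillator for each pair i <= j. *)
Definition osc (r : nat) := {p : 'I_r * 'I_r | (p.1 <= p.2)%N}.

(* The Fock module in the Bargmann realization: polynomials over C in the
   creation operators, one variable for each oscillator; 1 is the vacuum
   and a monomial in the creation operators applied to the vacuum is the
   corresponding mpolyX. *)
Definition fock (R : realType) (r : nat) := mpoly #|{: osc r}| R[i].

Section Endomorphisms.
Context (R : realType) (r : nat).
Let C : fieldType := R[i].
Let V : lmodType C := fock R r.

Definition is_endo : {pred V -> V} := fun f => `[< linear f >].

Lemma is_endoP (f : V -> V) : reflect (linear f) (f \in is_endo).
Proof. exact: asboolP. Qed.

Fact is_endo_submod : subsemimod_closed is_endo.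
Proof.
split; first split.
- by apply/is_endoP => a u v; rewrite scaler0 addr0.
- move=> f g /is_endoP lf /is_endoP lg; apply/is_endoP => a u v.
  by rewrite /= !fctE lf lg scalerDr addrACA.
- move=> c f /is_endoP lf; apply/is_endoP => a u v.
  by rewrite !fctE lf scalerDr !scalerA mulrC.
Qed.

HB.instance Definition _ :=
  GRing.isSubmodClosed.Build C (V -> V) is_endo is_endo_submod.

Record endo := Endo { endo_fun :> V -> V ; _ : endo_fun \in is_endo }.

HB.instance Definition _ := [isSub for endo_fun].
HB.instance Definition _ := [Choice of endo by <:].
HB.instance Definition _ := [SubChoice_isSubLmodule of endo by <:].

Fact endo_linear (f : endo) : linear f.
Proof. exact/is_endoP/(valP f). Qed.
HB.instance Definition _ (f : endo) :=
  GRing.isLinear.Build C V V *:%R f (endo_linear f).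

Lemma endoP (f g : endo) : f =1 g -> f = g.
Proof. by move=> fg; apply/val_inj/funext. Qed.

Definition mkendo (f : V -> V) (lf : linear f) : endo :=
  Endo (introT (is_endoP f) lf).

Definition endo1 : endo := mkendo (f := id) (fun _ _ _ => erefl).
Fact endo_mul_subproof (f g : endo) : linear (f \o g).
Proof. by move=> a u v; rewrite /= !linearP. Qed.
Definition endo_mul (f g : endo) : endo := mkendo (endo_mul_subproof f g).

Fact endo_mulA : associative endo_mul.
Proof. by move=> f g h; apply: endoP. Qed.
Fact endo_mul1f : left_id endo1 endo_mul.
Proof. by move=> f; apply: endoP. Qed.
Fact endo_mulf1 : right_id endo1 endo_mul.
Proof. by move=> f; apply: endoP. Qed.
Fact endo_mulDl : left_distributive endo_mul +%R.
Proof. by move=> f g h; apply: endoP. Qed.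
Fact endo_mulDr : right_distributive endo_mul +%R.
Proof. by move=> f g h; apply: endoP => v; exact: (linearD f). Qed.
Fact endo1_neq0 : endo1 != 0.
Proof.
apply/eqP => /(congr1 (fun f : endo => f (1 : fock R r))) /= /eqP.
by rewrite oner_eq0.
Qed.

HB.instance Definition _ := GRing.Zmodule_isNzRing.Build endo
  endo_mulA endo_mul1f endo_mulf1 endo_mulDl endo_mulDr endo1_neq0.

Fact endo_scaleAl (a : C) (f g : endo) : a *: (f * g) = (a *: f) * g.
Proof. exact: endoP. Qed.
HB.instance Definition _ := GRing.Lmodule_isLalgebra.Build C endo endo_scaleAl.

Fact endo_scaleAr (a : C) (f g : endo) : a *: (f * g) = f * (a *: g).
Proof. by apply: endoP => v; rewrite -[RHS]/(f (a *: g v)) linearZ. Qed.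
HB.instance Definition _ := GRing.Lalgebra_isAlgebra.Build C endo endo_scaleAr.

End Endomorphisms.

Section Operators.
Context (R : realType) (r : nat).
Local Notation C := R[i].
Local Notation V := (fock R r).
Local Notation E := (endo R r).

Fact creation_subproof (k : 'I_#|{: osc r}|) :
  linear (fun p : V => mpolyX C (mnm1 k) * p).
Proof. by move=> a u v; rewrite mulrDr scalerAr. Qed.

Definition creation (p : osc r) : E :=
  mkendo (creation_subproof (enum_rank p)).

Definition annihilation (p : osc r) : E :=
  mkendo (@mderiv_is_linear _ C (enum_rank p)).

Lemma ccr (p q : osc r) :
  annihilation p * creation q - creation q * annihilation p = (p == q)%:R.
Proof.
apply: endoP => v; rewrite -(inj_eq enum_rank_inj).
transitivity (mderiv (enum_rank p) (mpolyX C (mnm1 (enum_rank q))) * v).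
  rewrite [LHS]/(mderiv (enum_rank p) (mpolyX C (mnm1 (enum_rank q)) * v)
    - mpolyX C (mnm1 (enum_rank q)) * mderiv (enum_rank p) v) mderivM.
  exact: addrK.
rewrite mderivX mnm1E eq_sym.
case: eqP => [->|_]; last by rewrite scale0r mul0r.
rewrite scale1r (_ : mnm_sub _ _ = mnm0); first by rewrite mpolyX0 mul1r.
by apply/mnmP => k; rewrite mnmBE mnm0E subnn.
Qed.

Lemma annihilation_vacuum (p : osc r) : annihilation p (1 : V) = 0.
Proof. exact: (mderivC (enum_rank p) (1 : C)). Qed.

(* Only the values at i <= j, which label oscillators, are used. *)
Definition abar (i j : 'I_r) : E :=
  if insub (i, j) is Some p then creation p else 0.

Definition a (j i : 'I_r) : E :=
  if insub (i, j) is Some p then annihilation p else 0.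

Definition diag_op (lam : multinom #|{: osc r}| -> C) (p : V) : V :=
  \sum_(m <- msupp p) (lam m * mcoeff m p) *: mpolyX C m.

Lemma mcoeff_diag_op lam p m :
  mcoeff m (diag_op lam p) = lam m * mcoeff m p.
Proof.
rewrite /diag_op raddf_sum /=.
under eq_bigr do rewrite mcoeffZ mcoeffX.
have [mp|mp] := boolP (m \in msupp p).
  rewrite (bigD1_seq m) ?msupp_uniq //= eqxx mulr1 big1 ?addr0 // => k /negPf ->.
  by rewrite mulr0.
rewrite big_seq big1 => [|k kp]; first by rewrite (memN_msupp_eq0 mp) mulr0.
by case: eqP kp mp => [->|_ _ _]; [move=> -> | rewrite mulr0].
Qed.

Fact diag_op_linear lam : linear (diag_op lam).
Proof.
move=> c p q; apply/mpolyP => m.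
by rewrite mcoeffD mcoeffZ !mcoeff_diag_op mcoeffD mcoeffZ mulrDr mulrCA.
Qed.

(* tau ^ D = e ^ (xi D) for tau = e ^ xi and an operator D that is diagonal
   in the basis of monomials (which F_ii is): each basis vector is multiplied
   by e ^ (xi s), where s is the eigenvalue of D on it. *)
Definition tau_pow (xi : C) (D : E) : E :=
  mkendo (diag_op_linear
    (fun m => cexp (xi * mcoeff m (D (mpolyX C m : V))))).

(* Unconditional sum of the diagonal coefficients in the monomial basis. *)
Definition fock_tr (X : E) : C :=
  summability.sum (fun m : multinom #|{: osc r}| =>
    mcoeff m (X (mpolyX C m : V)) : (C : numFieldType)^o).

End Operators.

(* Rows and columns 1, ..., r, r', ..., 1' are numbered by 'I_(r + r): the
   label i is lshift r i and priming is rev_ord.  In the r x r blocks the row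
   (or column) with label j' has index rev_ord j. *)

Section Lax.
Context (K : comNzRingType) (E : algType K) (r : nat).
Context (b : 'I_r -> 'I_r -> E) (d : 'I_r -> 'I_r -> E).

(* b i j and d j i (i <= j) stand for the generators abar_(i,j') and
   a_(j',i), so that automorphisms act by substitution. *)

Definition Abar_mx : 'M[E]_r := \matrix_(i < r, c < r)
  let j := rev_ord c in
  if (i < j)%N then b i j else if i == j then 2%:R * b i i else b j i.

Definition A_mx : 'M[E]_r := \matrix_(c < r, i < r)
  let j := rev_ord c in if (i <= j)%N then d j i else d i j.

Definition lax (t x : K) : 'M[E]_(r + r) :=
  block_mx
    (((x + t)%:A)%:M - Abar_mx *m A_mx)
    (- (Abar_mx *m (((2%:R * t + r%:R + 1)%:A)%:M - A_mx *m Abar_mx)))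
    (- A_mx)
    (((x - t - r%:R - 1)%:A)%:M + A_mx *m Abar_mx).

End Lax.

Section Transfer.
Context (R : realType) (r : nat).
Local Notation C := R[i].
Local Notation E := (endo R r).

Definition B_mx (i : 'I_r) : 'M[C]_(r + r) :=
  let e := @delta_mx C (r + r) (r + r) in
  let l (j : 'I_r) := lshift r j in let l' j := rev_ord (l j) in
  e (l i) (l' i) - e (l' i) (l i)
  + \sum_(j < r | j != i) (e (l j) (l j) + e (l' j) (l' j)).

(* Sign vectors mu in {+1, -1}^r: mu j = true means mu_j = -1. *)

Definition Bmu_mx (mu : {ffun 'I_r -> bool}) : 'M[C]_(r + r) :=
  \prod_(j < r | mu j) B_mx j.

(* The images of the generators under abar |-> - a, a |-> abar for those
   i <= j with mu_i = -1. *)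
Definition abar_mu (mu : {ffun 'I_r -> bool}) (i j : 'I_r) : E :=
  if mu i then - a R j i else abar R i j.

Definition a_mu (mu : {ffun 'I_r -> bool}) (j i : 'I_r) : E :=
  if mu i then abar R i j else a R j i.

Definition lax_mu (mu : {ffun 'I_r -> bool}) (t x : C) : 'M[E]_(r + r) :=
  map_mx (in_alg E) (Bmu_mx mu)
  *m lax (abar_mu mu) (a_mu mu) t x
  *m map_mx (in_alg E) (invmx (Bmu_mx mu)).

(* lax_mu = x I + \sum_(i, j) e_ij F_ji *)
Definition F_mu (mu : {ffun 'I_r -> bool}) (t x : C) (j i : 'I_(r + r)) : E :=
  (lax_mu mu t x - (x%:A)%:M) i j.

(* End(C^(2r))^(tensor N) is identified with 'M_((2 r) ^ N) by the Kronecker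
   product; in ^t the entries are multiplied in E from the first tensor
   factor to the last. *)
Definition Tplus (N : nat) (xi : 'I_r -> C) (mu : {ffun 'I_r -> bool})
    (t x : C) : 'M[C]_((r + r) ^ N) :=
  \matrix_(p, q) fock_tr
    ((\prod_(i < r) tau_pow (xi i) (F_mu mu t x (lshift r i) (lshift r i)))
     * (lax_mu mu t x ^t N) p q).

(* \sum_(i : mu_i = -1) (r - i + 1) with i counted from 1 *)
Definition ell (mu : {ffun 'I_r -> bool}) : nat := \sum_(i < r | mu i) (r - i)%N.

Definition transfer (N : nat) (xi : 'I_r -> C) (t x : C) :
    'M[C]_((r + r) ^ N) :=
  \sum_(mu : {ffun 'I_r -> bool}) (-1) ^+ ell mu *: Tplus N xi mu t x.

End Transfer.

(* Main.v *)
Require Import Defs.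
From HB Require Import structures.
From mathcomp Require Import all_boot all_order all_algebra complex mxtens.
From mathcomp Require Import finmap ring lra.
From mathcomp Require Import all_classical all_reals all_analysis summability.
From mathcomp Require Import -(notations) mpoly.

Set Implicit Arguments.
Unset Strict Implicit.
Unset Printing Implicit Defensive.

Import Order.TTheory GRing.Theory Num.Theory numFieldNormedType.Exports.

Local Open Scope ring_scope.
Local Open Scope complex_scope.

(** The symmetry holds summand by summand: [Tplus] for the sign vector [mu] at
    [t] equals [Tplus] for the opposite sign vector [opp_sign mu] at
    [- r - 1 - t] ([Tplus_opp_sign]).  Reversing all signs is a permutation of
    the summands, and it changes [ell] from [l] to [r (r + 1) / 2 - l]
    ([ell_opp_sign]), whence the global sign.

    Both sides of that equality are twisted traces over the Fock module for two
    realizations of the Lie algebra sp_2r by polynomials in the oscillators.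
    Up to the scalar [x] on the diagonal, the entries of the Lax matrix are the
    generators [gen_mu] of such a realization ([lax_mu_entry]), and their
    structure constants depend neither on [mu] nor on [t] ([comm_gen_mu]): the
    substitution of the oscillators preserves the canonical commutation
    relations, from which the brackets are computed, and conjugation by the
    signed permutation [Bmu_mx], which preserves the symplectic form, does not
    change them.  The two
    realizations need not be isomorphic for exceptional [t], so no intertwiner
    is used.  Instead, their Cartan generators coincide as operators on the Fock
    module ([cartan_opp_sign]), hence so do the twists [prod tau_i ^ F_ii], and
    this already determines all traces.

    Indeed, let [h w] be the difference of the twisted traces of a word [w] in
    the generators.  Exchanging two adjacent letters changes [h w] by values of
    [h] on shorter words, and moving a letter cyclically past the twist
    multiplies [h w] by a character [twist_char] of the letter.  As
    [|tau_1| > ... > |tau_r| > 1], this character differs from 1 on every root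
    vector ([twist_char_eq1]), so that root vectors can be eliminated from a
    word by induction on its length; words in Cartan letters have the same
    trace on both sides ([twisted_trace_eq0]).

    The analytic input is that the twist is of trace class and that
    polynomials in the oscillators can be moved around the trace.  An operator
    is called of trace class here when its matrix in the monomial basis decays
    geometrically in both indices; this class is stable under multiplication
    by creation and annihilation operators, and for those cyclicity is a shift
    of the summation index ([cyclic_creation], [cyclic_annihilation]).  The
    twist is of trace class because each additional quantum multiplies its
    eigenvalue by [tau_i^-1 tau_j^(-1 or 1)] with [i <= j] (the sign being
    negative for [i = j]), which has modulus less than 1
    ([osc_weight_lt0], [trace_class_twist]). *)

(** * Unconditional sums of complex families *)

Section UnconditionalSums.
Context (R : realType) (I : choiceType).
Local Notation C := R[i].

Definition has_sum (f : I -> C) (s : C) : Prop :=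
  forall e : R, 0 < e -> exists A : {fset I}, 
    forall B : {fset I}, (A `<=` B)%fset -> `|\sum_(i <- B) f i - s| < e%:C.

Definition abs_summable (f : I -> C) : Prop :=
  exists M : R, forall A : {fset I}, \sum_(i <- A) `|f i| <= M%:C.

(** [summability.sum] is a total function whose value is meaningful only for
    convergent families, so that convergence is always established in the form
    [has_sum] first. *)
Lemma has_sum_lim (f : I -> C) (s : C) : has_sum f s ->
  summability.sum (f : I -> (C : numFieldType)^o) = s.
Proof.
move=> fs; rewrite /summability.sum.
have FF : ProperFilter (@totally I) := totally_filter.
apply: cvg_lim; first exact: norm_hausdorff.
apply/cvgrPdist_lt => e; rewrite ltcE /= => /andP[/eqP im0 re0].
have [A hA] := fs _ re0.
exists A => // B /= AB; rewrite distrC.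
have -> : e = (complex.Re e)%:C by case: e im0 {re0 hA} => x y /= ->.
by rewrite /partial_sum -(big_seq_fsetE _ _ predT f) /=; exact: hA.
Qed.

(** The partial sums of a nonnegative family increase to their supremum. *)
Lemma has_sum_sup (g : I -> R) (M : R) :
  (forall i, 0 <= g i) -> (forall A : {fset I}, \sum_(i <- A) g i <= M) ->
  exists s : R, has_sum (fun i => (g i)%:C) s%:C.
Proof.
move=> g0 gM.
pose E : set R := [set \sum_(i <- A) g i | A in @setT {fset I}]%classic.
have hE : has_sup E.
  split; first by exists (\sum_(i <- fset0) g i); exists fset0.
  by exists M => _ [A _ <-]; exact: gM.
exists (sup E) => e e0.
have [_ [A _ <-] hA] := sup_adherent e0 hE.
exists A => B AB.
rewrite -(raddf_sum (real_complex R)) -raddfB /= normc_def /= expr0n addr0 /=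
  sqrtr_sqr ltcR.
have AB' : \sum_(i <- A) g i <= \sum_(i <- B) g i.
  rewrite [leRHS](big_fsetID _ (mem A)) /=.
  rewrite [X in _ <= X + _](_ : _ = \sum_(i <- A) g i); last first.
    apply: perm_big; apply: uniq_perm; rewrite ?fset_uniq //= => i.
    by rewrite !inE /= andbC; case: (boolP (i \in A)) => // /(fsubsetP AB) ->.
  by rewrite lerDl sumr_ge0.
have BE : \sum_(i <- B) g i <= sup E by apply: (ub_le_sup hE.2); exists B.
by rewrite ler0_norm ?subr_le0 // opprB ltrBlDl -ltrBlDr (lt_le_trans hA).
Qed.

Lemma has_sum0 : has_sum (fun=> 0) 0.
Proof.
by move=> e e0; exists fset0 => B _; rewrite big1 // subr0 normr0 ltcR.
Qed.

Lemma has_sumD f g s t :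
  has_sum f s -> has_sum g t -> has_sum (fun i => f i + g i) (s + t).
Proof.
move=> fs gt e e0; have e20 : 0 < e / 2 by rewrite divr_gt0.
have [A hA] := fs _ e20; have [B hB] := gt _ e20.
exists (A `|` B)%fset => D; rewrite fsubUset => /andP[AD BD].
rewrite big_split /= opprD addrACA (le_lt_trans (ler_normD _ _)) //.
by rewrite (splitr e) rmorphD ltrD ?hA ?hB.
Qed.

Lemma has_sumZ c f s : has_sum f s -> has_sum (fun i => c * f i) (c * s).
Proof.
move=> fs; have [->|c0] := eqVneq c 0.
  by under eq_fun do rewrite mul0r; rewrite mul0r; exact: has_sum0.
move=> e e0; have c0' : 0 < Normc.normc c.
  by rewrite -ltcR -[X in _ < X]/(`|c|) normr_gt0.
have [A hA] := fs (e / Normc.normc c) (divr_gt0 e0 c0').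
exists A => B AB; rewrite -mulr_sumr -mulrBr normrM.
have -> : e%:C = `|c| * (e / Normc.normc c)%:C.
  rewrite -[ `|c|]/((Normc.normc c)%:C) -rmorphM /= mulrC divfK //.
  by rewrite gt_eqF.
by rewrite ltr_pM2l ?hA // normr_gt0.
Qed.

(** Convergence is reduced to that of four nonnegative real families dominated
    by the norm of [f]: any real [u] is [|u| - 2 * ((|u| - u) / 2)], applied to
    the real and imaginary parts. *)
Lemma abs_summable_has_sum f : abs_summable f -> exists s, has_sum f s.
Proof.
case=> M hM.
have bnd (g : I -> R) : (forall i, 0 <= g i <= Normc.normc (f i)) ->
    exists s : R, has_sum (fun i => (g i)%:C) s%:C.
  move=> hg; apply: (@has_sum_sup _ M) => [i|A]; first by case/andP: (hg i).
  rewrite -lecR (le_trans _ (hM A)) // raddf_sum /=; apply: ler_sum => i _.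
  by rewrite -[ `|f i|]/((Normc.normc (f i))%:C) lecR; case/andP: (hg i).
have Reb i : `|complex.Re (f i)| <= Normc.normc (f i).
  by case: (f i) => a b /=; rewrite -sqrtr_sqr ler_wsqrtr // lerDl sqr_ge0.
have Imb i : `|complex.Im (f i)| <= Normc.normc (f i).
  by case: (f i) => a b /=; rewrite -sqrtr_sqr ler_wsqrtr // lerDr sqr_ge0.
have [s1 h1] : exists s : R, has_sum (fun i => `|complex.Re (f i)|%:C) s%:C.
  by apply: bnd => i; rewrite normr_ge0 Reb.
have [s2 h2] : exists s : R,
    has_sum (fun i => ((`|complex.Re (f i)| - complex.Re (f i)) / 2)%:C) s%:C.
  apply: bnd => i; rewrite divr_ge0 ?subr_ge0 ?ler_norm //=.
  rewrite (le_trans _ (Reb i)) // ler_pdivrMr // mulr_natr mulr2n lerD2l.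
  by rewrite -normrN ler_norm.
have [s3 h3] : exists s : R, has_sum (fun i => `|complex.Im (f i)|%:C) s%:C.
  by apply: bnd => i; rewrite normr_ge0 Imb.
have [s4 h4] : exists s : R,
    has_sum (fun i => ((`|complex.Im (f i)| - complex.Im (f i)) / 2)%:C) s%:C.
  apply: bnd => i; rewrite divr_ge0 ?subr_ge0 ?ler_norm //=.
  rewrite (le_trans _ (Imb i)) // ler_pdivrMr // mulr_natr mulr2n lerD2l.
  by rewrite -normrN ler_norm.
exists ((s1%:C + (- 2) * s2%:C) + 'i * (s3%:C + (- 2) * s4%:C)).
have -> : f = fun i => (`|complex.Re (f i)|%:C
     + (- 2) * ((`|complex.Re (f i)| - complex.Re (f i)) / 2)%:C)
     + 'i * (`|complex.Im (f i)|%:C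
     + (- 2) * ((`|complex.Im (f i)| - complex.Im (f i)) / 2)%:C).
  apply/funext => i.
  have h (u v : R) : u%:C + (- 2) * ((u - v) / 2)%:C = v%:C :> C.
    have -> : - 2 = (- 2)%:C :> C by rewrite rmorphN rmorph_nat.
    rewrite -rmorphM -rmorphD /=; congr (_%:C).
    by rewrite mulNr mulrC divfK ?pnatr_eq0 // opprB addrC subrK.
  rewrite !h; exact: complexE.
by apply: has_sumD; [|apply: has_sumZ]; apply: has_sumD => //; apply: has_sumZ.
Qed.

(** Terms outside the image of [h] vanish, so a finite set containing the image
    of [A] has the same sum as its preimage, which contains [A]. *)
Lemma has_sum_reindex (h : I -> I) f s : injective h ->
  (forall i, f i != 0 -> exists j, i = h j) ->
  has_sum (f \o h) s -> has_sum f s.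
Proof.
move=> hinj hf fs e /fs[A hA].
exists [fset h i | i in A]%fset => B AB.
pose g i := xget i [set j | i = h j]%classic.
have gK : cancel h g.
  by move=> j; apply: hinj; rewrite /g; case: xgetP => [k _ <-//|/(_ j)[]].
pose D := [fset i in [fset g i | i in B] | h i \in B]%fset.
have -> : \sum_(i <- B) f i = \sum_(i <- D) (f \o h) i.
  rewrite (big_fsetID _ (fun i => f i != 0)) /=.
  rewrite [X in _ + X]big1_fset => [|i]; last first.
    by rewrite !inE /= => /andP[_ /negPn/eqP].
  rewrite addr0.
  rewrite [RHS](big_fsetID _ (fun i => f (h i) != 0)) /=.
  rewrite [X in _ = _ + X]big1_fset => [|i]; last first.
    by rewrite !inE /= => /andP[_ /negPn/eqP].
  rewrite addr0 -(big_map h predT f).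
  apply: perm_big; apply: uniq_perm; rewrite ?fset_uniq ?map_inj_uniq
    ?fset_uniq // => i.
  apply/idP/mapP => [|[j + ->]]; rewrite !inE /=;
    last by case/andP => /andP[_ ->].
  move=> /andP[iB fi]; have [j ij] := hf _ fi.
  exists j => //; rewrite !inE /= -ij iB fi !andbT.
  by apply/imfsetP; exists i => //=; rewrite ij gK.
apply: hA; apply/fsubsetP => i iA; rewrite !inE /=.
have hiB : h i \in B by apply: (fsubsetP AB); rewrite in_imfset.
by rewrite hiB andbT; apply/imfsetP; exists (h i); rewrite ?gK.
Qed.

End UnconditionalSums.

(** * Trace class operators on the Fock module *)

Section TraceClass.
Context (R : realType) (r : nat).
Local Notation C := R[i].
Local Notation V := (fock R r).
Local Notation E := (endo R r).
Local Notation M := (multinom #|{: osc r}|).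

Definition mel (X : E) (m' m : M) : C := mcoeff m' (X (mpolyX C m : V)).

(** Geometric decay of the whole matrix, in both indices: unlike summability of
    the diagonal, this is stable under multiplication on either side by
    creation and annihilation operators. *)
Definition trace_class (X : E) : Prop :=
  exists c s : R, [/\ 0 <= c, 0 < s, s < 1 &
    forall m' m, `|mel X m' m| <= (c * s ^+ (mdeg m' + mdeg m))%:C].

Lemma endoM (X Y : E) v : (X * Y) v = X (Y v). Proof. by []. Qed.
Lemma endoD (X Y : E) v : (X + Y) v = X v + Y v. Proof. by []. Qed.
Lemma endoZ a (X : E) v : (a *: X) v = a *: X v. Proof. by []. Qed.

Lemma endoN (X : E) v : (- X) v = - X v. Proof. by []. Qed.

Lemma melD X Y m' m : mel (X + Y) m' m = mel X m' m + mel Y m' m.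
Proof. by rewrite /mel endoD mcoeffD. Qed.

Lemma melZ a X m' m : mel (a *: X) m' m = a * mel X m' m.
Proof. by rewrite /mel endoZ mcoeffZ. Qed.

Lemma sub1mK i (m : M) : m i != 0%N ->
  mnm_add (mnm_sub m (mnm1 i)) (mnm1 i) = m.
Proof. by move=> mi; apply: submK; rewrite lep1mP. Qed.

Lemma mdegS_ex (m : M) n : mdeg m = n.+1 ->
  exists i, m i != 0%N /\ mdeg (mnm_sub m (mnm1 i)) = n.
Proof.
move=> mn; have [i m0] : exists i, m i != 0%N.
  apply/existsP; rewrite -negb_forall; apply/forallP => m0.
  by move: mn; rewrite mdegE big1 // => i _; exact/eqP.
by exists i; split=> //; move: mn; rewrite -{1}(sub1mK m0) mdegD mdeg1 addn1
  => -[].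
Qed.

Lemma mcoeffXM_eq0 i (p : V) (m : M) :
  m i = 0%N -> mcoeff m (mpolyX C (mnm1 i) * p) = 0.
Proof.
move=> mi; rewrite [p]mpolyE mulr_sumr raddf_sum /= big1 // => k _.
rewrite -scalerAr mcoeffZ -mpolyXD mcoeffX.
case: eqP => [km|]; last by rewrite mulr0.
by move: mi; rewrite -km mnmDE mnm1E eqxx.
Qed.

Lemma mel_creation_l p X m' m : mel (creation R p * X) m' m =
  if m' (enum_rank p) == 0%N then 0
  else mel X (mnm_sub m' (mnm1 (enum_rank p))) m.
Proof.
rewrite /mel endoM /= /creation /=; case: eqP => [/mcoeffXM_eq0->//|/eqP m0].
by rewrite -{1}(sub1mK m0) addmC [_ * _]mulrC mcoeffMX.
Qed.

Lemma mel_creation_r p X m' m : mel (X * creation R p) m' m =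
  mel X m' (mnm_add m (mnm1 (enum_rank p))).
Proof. by rewrite /mel endoM /creation /= -mpolyXD addmC. Qed.

Lemma mel_annihilation_l p X m' m : mel (annihilation R p * X) m' m =
  mel X (mnm_add m' (mnm1 (enum_rank p))) m *+ (m' (enum_rank p)).+1.
Proof. by rewrite /mel endoM /annihilation /= mcoeff_mderiv. Qed.

Lemma mel_annihilation_r p X m' m : mel (X * annihilation R p) m' m =
  (m (enum_rank p))%:R * mel X m' (mnm_sub m (mnm1 (enum_rank p))).
Proof. by rewrite /mel endoM /annihilation /= mderivX linearZ mcoeffZ. Qed.

(** Used to absorb the linear factors produced by differentiation into a
    slightly worse ratio, by Bernoulli's inequality. *)
Lemma linear_geometric_bound (s : R) : 0 < s -> s < 1 ->
  exists K s' : R, [/\ 0 <= K, 0 < s', s' < 1 &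
    forall k, k.+1%:R * s ^+ k <= K * s' ^+ k].
Proof.
move=> s0 s1; pose s' : R := (1 + s) / 2; pose h := s' / s - 1.
have h0 : 0 < h by rewrite /h subr_gt0 ltr_pdivlMr // mul1r /s'; lra.
have hs : s' = (1 + h) * s by rewrite /h addrC subrK divfK // gt_eqF.
clearbody h.
(* Bernoulli's inequality for the ratio s' / s. *)
have bern k : 1 + k%:R * h <= (1 + h) ^+ k.
  elim: k => [|k IH]; first by rewrite mul0r addr0 expr0.
  rewrite exprS (le_trans _ (ler_wpM2l _ IH)) ?addr_ge0 ?(ltW h0) //.
  rewrite -natr1 -subr_ge0 [leRHS](_ : _ = k%:R * h * h); last by ring.
  by rewrite !mulr_ge0 ?ler0n ?(ltW h0).
exists (1 + h^-1); exists s'; split.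
- by rewrite addr_ge0 // invr_ge0 (ltW h0).
- by rewrite /s'; lra.
- by rewrite /s'; lra.
move=> k; rewrite hs exprMn mulrA ler_wpM2r ?exprn_ge0 ?(ltW s0) //.
apply: le_trans (ler_wpM2l _ (bern k));
  last by rewrite addr_ge0 // invr_ge0 (ltW h0).
rewrite mulrDl mul1r mulrDr mulr1 mulrCA mulVf ?gt_eqF // mulr1 -natr1.
have : 0 <= k%:R * h by rewrite mulr_ge0 ?ler0n ?(ltW h0).
have : 0 < h^-1 by rewrite invr_gt0.
lra.
Qed.

Lemma trace_classD X Y : trace_class X -> trace_class Y -> trace_class (X + Y).
Proof.
move=> [c1 [s1 [c10 s10 s11 h1]]] [c2 [s2 [c20 s20 s21 h2]]].
exists (c1 + c2); exists (Num.max s1 s2); split; rewrite ?addr_ge0 //.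
- by rewrite lt_max s10.
- by rewrite gt_max s11.
move=> m' m; rewrite melD (le_trans (ler_normD _ _)) // mulrDl rmorphD.
have m0 : 0 <= Num.max s1 s2 by rewrite le_max (ltW s10).
apply: lerD.
- rewrite (le_trans (h1 _ _)) // lecR ler_wpM2l //.
  by rewrite lerXn2r ?nnegrE ?(ltW s10) // le_max lexx.
- rewrite (le_trans (h2 _ _)) // lecR ler_wpM2l //.
  by rewrite lerXn2r ?nnegrE ?(ltW s20) // le_max lexx orbT.
Qed.

Lemma trace_classZ a X : trace_class X -> trace_class (a *: X).
Proof.
move=> [c [s [c0 s0 s1 h]]].
exists (Normc.normc a * c); exists s; split=> //.
  by rewrite mulr_ge0 // -lecR -[X in _ <= X]/(`|a|) normr_ge0.
move=> m' m; rewrite melZ normrM -mulrA rmorphM.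
exact: (ler_wpM2l (normr_ge0 a) (h m' m)).
Qed.

Lemma trace_class_linear_bound (c s : R) X : 0 <= c -> 0 < s -> s < 1 ->
  (forall m' m, `|mel X m' m| <=
     ((mdeg m' + mdeg m).+1%:R * (c * s ^+ (mdeg m' + mdeg m)))%:C) ->
  trace_class X.
Proof.
move=> c0 s0 s1 h; have [K [s' [K0 s'0 s'1 hK]]] := linear_geometric_bound s0
  s1.
exists (c * K); exists s'; split; rewrite ?mulr_ge0 // => m' m.
by rewrite (le_trans (h _ _)) // lecR mulrCA -mulrA ler_wpM2l.
Qed.

Lemma trace_class_creation_l p X :
  trace_class X -> trace_class (creation R p * X).
Proof.
move=> [c [s [c0 s0 s1 h]]]; exists (c / s); exists s; split=> //.
  by rewrite divr_ge0 // ltW.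
move=> m' m; rewrite mel_creation_l; case: eqP => [_|/eqP m0].
  by rewrite normr0 lecR mulr_ge0 ?exprn_ge0 ?divr_ge0 // ltW.
rewrite (le_trans (h _ _)) // lecR -{2}(sub1mK m0) mdegD mdeg1 addn1 addSn
  exprS.
by rewrite mulrA divfK // gt_eqF.
Qed.

Lemma trace_class_creation_r p X :
  trace_class X -> trace_class (X * creation R p).
Proof.
move=> [c [s [c0 s0 s1 h]]]; exists (c * s); exists s; split=> //.
  by rewrite mulr_ge0 // ltW.
move=> m' m; rewrite mel_creation_r (le_trans (h _ _)) // lecR.
by rewrite mdegD mdeg1 addn1 addnS exprS mulrA.
Qed.

Lemma mnm_le_mdeg i (m : M) : (m i <= mdeg m)%N.
Proof. by rewrite mdegE (bigD1 i) //= leq_addr. Qed.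

Lemma trace_class_annihilation_l p X :
  trace_class X -> trace_class (annihilation R p * X).
Proof.
move=> [c [s [c0 s0 s1 h]]].
apply: (@trace_class_linear_bound (c * s) s) => //;
  first by rewrite mulr_ge0 // ltW.
move=> m' m; rewrite mel_annihilation_l -[_ *+ (m' _).+1]mulr_natl normrM
  rmorphM normr_nat rmorph_nat.
apply: ler_pM; rewrite ?normr_ge0 ?ler0n //.
  by rewrite ler_nat ltnS (leq_trans (mnm_le_mdeg _ _)) // leq_addr.
rewrite (le_trans (h _ _)) // lecR.
by rewrite mdegD mdeg1 addn1 addSn exprS mulrA.
Qed.

Lemma trace_class_annihilation_r p X :
  trace_class X -> trace_class (X * annihilation R p).
Proof.
move=> [c [s [c0 s0 s1 h]]].
apply: (@trace_class_linear_bound (c / s) s) => //;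
  first by rewrite divr_ge0 // ltW.
move=> m' m; rewrite mel_annihilation_r normrM rmorphM normr_nat rmorph_nat.
have [m0|m0] := eqVneq (m (enum_rank p)) 0%N.
  rewrite m0 mul0r mulr_ge0 ?ler0n // lecR.
  by rewrite mulr_ge0 ?exprn_ge0 ?divr_ge0 // ltW.
apply: ler_pM; rewrite ?normr_ge0 ?ler0n //.
  by rewrite ler_nat leqW // (leq_trans (mnm_le_mdeg _ _)) // leq_addl.
rewrite (le_trans (h _ _)) // lecR -{2}(sub1mK m0) mdegD mdeg1 addn1 addnS
  exprS.
by rewrite mulrA divfK // gt_eqF.
Qed.

(** A finite set of multi-indices is contained in a cube, over which the sum is
    a product of [n] geometric sums. *)
Lemma geometric_multisum (n : nat) (s : R) (A : {fset multinom n}) :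
  0 < s -> s < 1 -> \sum_(m <- A) s ^+ mdeg m <= (1 - s)^-1 ^+ n.
Proof.
move=> s0 s1; pose K := \max_(m <- A) mdeg m.
pose phi (m : multinom n) : {ffun 'I_n -> 'I_K.+1} := [ffun i => inord (m i)].
pose F (f : {ffun 'I_n -> 'I_K.+1}) : R := \prod_i s ^+ f i.
have phiE m i : m \in A -> phi m i = m i :> nat.
  move=> mA; rewrite ffunE inordK // ltnS.
  apply: leq_trans (leq_bigmax_seq _ mA isT).
  by rewrite mdegE (bigD1 i) //= leq_addr.
have -> : \sum_(m <- A) s ^+ mdeg m = \sum_(f <- map phi A) F f.
  rewrite big_map; apply: eq_big_seq => m mA.
  by rewrite mdegE expr_sum; apply: eq_bigr => i _; rewrite phiE.
have F0 f : 0 <= F f by apply: prodr_ge0 => i _; rewrite exprn_ge0 // ltW.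
rewrite big_uniq /=; last first.
  rewrite map_inj_in_uniq ?fset_uniq // => m1 m2 m1A m2A e.
  by apply/mnmP => i; rewrite -(phiE m1) // -(phiE m2) // e.
apply: (@le_trans _ _ (\sum_f F f)).
  by rewrite [leRHS](bigID (mem (map phi A))) /= lerDl sumr_ge0.
rewrite /F -(bigA_distr_bigA (fun _ (j : 'I_K.+1) => s ^+ j)).
rewrite prodr_const card_ord lerXn2r ?nnegrE ?invr_ge0 ?subr_ge0 ?(ltW s1) //.
  by rewrite sumr_ge0 // => j _; rewrite exprn_ge0 // ltW.
rewrite -[leRHS]mul1r ler_pdivlMr ?subr_gt0 // mulrC.
by rewrite -[1 - s]opprB mulNr -subrX1 opprB lerBlDr lerDl exprn_ge0 ?(ltW s0).
Qed.

Lemma trace_class_has_sum X : trace_class X ->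
  has_sum (fun m => mel X m m) (fock_tr X).
Proof.
move=> [c [s [c0 s0 s1 h]]].
have [t ht] : exists t, has_sum (fun m => mel X m m) t.
  apply: abs_summable_has_sum; exists (c * (1 - s)^-1 ^+ #|{: osc r}|) => A.
  apply: (@le_trans _ _ ((\sum_(m <- A) c * s ^+ mdeg m)%:C)); last first.
    by rewrite lecR -mulr_sumr ler_wpM2l // geometric_multisum.
  rewrite raddf_sum; apply: ler_sum => m _; rewrite (le_trans (h _ _)) // lecR.
  by rewrite ler_wpM2l // ler_wiXn2l ?leq_addl // ltW.
suff -> : fock_tr X = t by [].
exact: (has_sum_lim ht).
Qed.

Lemma fock_trD X Y : trace_class X -> trace_class Y ->
  fock_tr (X + Y) = fock_tr X + fock_tr Y.
Proof.
move=> /trace_class_has_sum hX /trace_class_has_sum hY.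
apply: (has_sum_lim (f := fun m => mel (X + Y) m m)).
rewrite (_ : (fun m => _) = fun m => mel X m m + mel Y m m); last first.
  by apply/funext => m; exact: melD.
exact: has_sumD.
Qed.

Lemma fock_trZ a X : trace_class X -> fock_tr (a *: X) = a * fock_tr X.
Proof.
move=> /trace_class_has_sum hX.
apply: (has_sum_lim (f := fun m => mel (a *: X) m m)).
rewrite (_ : (fun m => _) = fun m => a * mel X m m); last first.
  by apply/funext => m; exact: melZ.
exact: has_sumZ.
Qed.

(** [Y] can be moved around the trace.  The stability of the trace class under
    multiplication by [Y] is included, so that [cyclic] is itself stable under
    products. *)
Definition cyclic (Y : E) : Prop := forall X, trace_class X ->
  [/\ trace_class (Y * X), trace_class (X * Y) &
      fock_tr (Y * X) = fock_tr (X * Y)].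

Lemma add1m_inj i : injective (fun m : M => mnm_add m (mnm1 i)).
Proof. by move=> m1 m2; rewrite ![mnm_add _ (mnm1 i)]addmC => /addmI. Qed.

(** The diagonals of both products agree up to the shift of the summation index
    that adds one quantum; the terms missed by the shift vanish. *)
Lemma cyclic_creation p : cyclic (creation R p).
Proof.
move=> X tX; have tr := trace_class_creation_r p tX.
split=> //; first exact: trace_class_creation_l.
apply: (has_sum_lim (f := fun m => mel (creation R p * X) m m)).
apply: (has_sum_reindex (@add1m_inj (enum_rank p))) => [m|].
  rewrite mel_creation_l.
  have [_|m0 _] := eqVneq (m (enum_rank p)) 0%N; first by rewrite eqxx.
  by exists (mnm_sub m (mnm1 (enum_rank p))); rewrite sub1mK.
have := trace_class_has_sum tr; congr has_sum; apply/funext => m /=.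
by rewrite mel_creation_r mel_creation_l mnmDE mnm1E eqxx addn1 /= addmK.
Qed.

Lemma cyclic_annihilation p : cyclic (annihilation R p).
Proof.
move=> X tX; have tl := trace_class_annihilation_l p tX.
split=> //; first exact: trace_class_annihilation_r.
apply/esym/(has_sum_lim (f := fun m => mel (X * annihilation R p) m m)).
apply: (has_sum_reindex (@add1m_inj (enum_rank p))) => [m|].
  rewrite mel_annihilation_r.
  have [->|m0 _] := eqVneq (m (enum_rank p)) 0%N; first by rewrite mul0r eqxx.
  by exists (mnm_sub m (mnm1 (enum_rank p))); rewrite sub1mK.
have := trace_class_has_sum tl; congr has_sum; apply/funext => m /=.
rewrite mel_annihilation_l mel_annihilation_r mnmDE mnm1E eqxx addn1 /= addmK.
by rewrite mulr_natl.
Qed.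

Lemma cyclicD Y Z : cyclic Y -> cyclic Z -> cyclic (Y + Z).
Proof.
move=> cY cZ X tX; have [y1 y2 y3] := cY X tX; have [z1 z2 z3] := cZ X tX.
rewrite mulrDl mulrDr; split; try exact: trace_classD.
by rewrite !fock_trD // y3 z3.
Qed.

Lemma cyclicZ a Y : cyclic Y -> cyclic (a *: Y).
Proof.
move=> cY X tX; have [y1 y2 y3] := cY X tX.
rewrite -scalerAl -scalerAr; split; try exact: trace_classZ.
by rewrite !fock_trZ // y3.
Qed.

Lemma cyclicN Y : cyclic Y -> cyclic (- Y).
Proof. by rewrite -scaleN1r; exact: cyclicZ. Qed.

Lemma cyclicM Y Z : cyclic Y -> cyclic Z -> cyclic (Y * Z).
Proof.
move=> cY cZ X tX; have [y1 y2 y3] := cY X tX; have [z1 z2 z3] := cZ X tX.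
have [a1 a2 a3] := cY _ z1; have [b1 b2 b3] := cZ _ y2.
by rewrite mulrA -mulrA; split=> //; rewrite ?a3 -?mulrA ?b3 ?mulrA // -?mulrA.
Qed.

Lemma cyclic1 : cyclic 1.
Proof. by move=> X tX; rewrite mul1r mulr1. Qed.

Lemma cyclic0 : cyclic 0.
Proof. by rewrite -(scale0r 1); apply: cyclicZ; exact: cyclic1. Qed.

Lemma cyclic_sum (I : Type) (l : seq I) (P : pred I) (F : I -> E) :
  (forall i, P i -> cyclic (F i)) -> cyclic (\sum_(i <- l | P i) F i).
Proof.
by move=> h; apply: big_ind; [exact: cyclic0|exact: cyclicD|exact: h].
Qed.

Lemma cyclic_prod (I : Type) (l : seq I) (F : I -> E) :
  (forall i, cyclic (F i)) -> cyclic (\prod_(i <- l) F i).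
Proof.
by move=> h; apply: big_ind => [||i _]; [exact: cyclic1|exact: cyclicM|].
Qed.

End TraceClass.

(** * Functionals on words determined by their twisted cyclicity *)

(** Modulo shorter words, where [h] vanishes by induction, a letter [j] can be
    moved freely within a word.  Moving it to the front and then cyclically to
    the back gives [h w = chi j * h w], which forces [h w = 0] unless
    [chi j = 1]. *)
Lemma twisted_trace_eq0 (K : fieldType) (J : eqType) (chi : J -> K)
    (br : J -> J -> seq (K * J)) (h : seq J -> K) :
  (forall u j k v, h (u ++ [:: j, k & v]) =
     h (u ++ [:: k, j & v]) + \sum_(p <- br j k) p.1 * h (u ++ p.2 :: v)) ->
  (forall j w, h (j :: w) = chi j * h (rcons w j)) ->
  (forall w, all (fun j => chi j == 1) w -> h w = 0) ->
  forall w, h w = 0.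
Proof.
move=> swap cyc diag w; have [n] := ubnP (size w).
elim: n w => // n IH w wn.
have [allw|] := boolP (all (fun j => chi j == 1) w); first exact: diag.
case/allPn => j jw chij; case/splitPr: jw wn => u v wn.
have sw x y k z : ((size x + size z).+1 < n)%N ->
      h (x ++ [:: y, k & z]) = h (x ++ [:: k, y & z]).
  move=> xz; rewrite swap big1 ?addr0 // => p _.
  by rewrite IH ?mulr0 // size_cat /= addnS.
have front x z : (size x + size z < n)%N -> h (x ++ j :: z) = h (j :: x ++ z).
  elim/last_ind: x z => [|x y IHx] z //; rewrite size_rcons addSn => xz.
  by rewrite !cat_rcons sw // IHx //= addnS.
have back : h (rcons (u ++ v) j) = h (j :: u ++ v).
  rewrite -cats1 front ?cats0 // addn0.
  by move: wn; rewrite !size_cat /= addnS ltnS.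
have uv : h (u ++ j :: v) = h (j :: u ++ v).
  by apply: front; move: wn; rewrite size_cat /= addnS ltnS.
have /eqP := cyc j (u ++ v); rewrite back -subr_eq0 -{1}[h _]mul1r -mulrBl
  mulf_eq0.
by rewrite subr_eq0 eq_sym (negPf chij) /= uv => /eqP.
Qed.
(** * Brackets of the oscillator realization of sp_2r *)

Section Commutators.
Context (K : comNzRingType) (E : algType K).
Implicit Types x y z : E.

Definition comm x y := x * y - y * x.

Lemma commC x y : comm x y = - comm y x.
Proof. by rewrite /comm opprB. Qed.

Lemma commMl x y z : comm (x * y) z = x * comm y z + comm x z * y.
Proof. by rewrite /comm mulrBr mulrBl !mulrA addrA subrK. Qed.

Lemma commMr x y z : comm x (y * z) = comm x y * z + y * comm x z.
Proof. by rewrite /comm mulrBr mulrBl !mulrA addrA subrK. Qed.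

Lemma commDl x y z : comm (x + y) z = comm x z + comm y z.
Proof. by rewrite /comm mulrDl mulrDr opprD addrACA. Qed.

Lemma commDr x y z : comm x (y + z) = comm x y + comm x z.
Proof. by rewrite /comm mulrDl mulrDr opprD addrACA. Qed.

Lemma commNl x y : comm (- x) y = - comm x y.
Proof. by rewrite /comm mulNr mulrN opprB opprK addrC. Qed.

Lemma commNr x y : comm x (- y) = - comm x y.
Proof. by rewrite commC commNl -commC. Qed.

Lemma commBl x y z : comm (x - y) z = comm x z - comm y z.
Proof. by rewrite commDl commNl. Qed.

Lemma commBr x y z : comm x (y - z) = comm x y - comm x z.
Proof. by rewrite commDr commNr. Qed.

Lemma commZl a x y : comm (a *: x) y = a *: comm x y.
Proof. by rewrite /comm -scalerAl -scalerAr -scalerBr. Qed.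

Lemma commZr a x y : comm x (a *: y) = a *: comm x y.
Proof. by rewrite /comm -scalerAl -scalerAr -scalerBr. Qed.

Lemma comm_sumr (I : Type) (l : seq I) (F : I -> E) x :
  comm x (\sum_(i <- l) F i) = \sum_(i <- l) comm x (F i).
Proof. by rewrite /comm mulr_sumr mulr_suml sumrB. Qed.

Lemma comm_suml (I : Type) (l : seq I) (F : I -> E) x :
  comm (\sum_(i <- l) F i) x = \sum_(i <- l) comm (F i) x.
Proof. by rewrite /comm mulr_sumr mulr_suml sumrB. Qed.

Lemma comm_algl a x : comm (a%:A) x = 0.
Proof. by rewrite /comm -scalerAl mul1r -scalerAr mulr1 subrr. Qed.

Lemma sum_deltar (n : nat) (F : 'I_n -> E) i : \sum_k F k *+ (i == k) = F i.
Proof.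
rewrite (bigD1 i) //= eqxx big1 ?addr0 // => k.
by rewrite eq_sym => /negPf->.
Qed.

Lemma sum_deltal (n : nat) (F : 'I_n -> E) i : \sum_k F k *+ (k == i) = F i.
Proof. by under eq_bigr do rewrite eq_sym; exact: sum_deltar. Qed.

End Commutators.

(** [asym] and [bsym] are the symmetric matrices of annihilation and creation
    operators.  With [asym] as lower left block, [levi] gives the gl_r block
    and [upper] the remaining abelian block, of second order in [asym]. *)
Section OscillatorRealization.
Context (K : comNzRingType) (E : algType K) (r : nat).
Context (asym bsym : 'I_r -> 'I_r -> E) (t : K).
Hypothesis asymC : forall i j, asym i j = asym j i.
Hypothesis bsymC : forall i j, bsym i j = bsym j i.
Hypothesis comm_asym : forall i j k l, comm (asym i j) (asym k l) = 0.
Hypothesis comm_bsym : forall i j k l, comm (bsym i j) (bsym k l) = 0.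
Hypothesis comm_asym_bsym : forall i j k l, comm (asym i j) (bsym k l) =
  1 *+ (i == k) *+ (j == l) + 1 *+ (i == l) *+ (j == k).

(** [levi] and [upper] are locked: otherwise rewriting and unification look
    through them and search the sums inside. *)
Definition levi i j : E :=
  locked (t%:A *+ (i == j) - \sum_k bsym i k * asym k j).

(** This is [bsym (2 t + r + 1 - asym bsym)] with the annihilators moved to the
    right, written in terms of [levi] so that its brackets follow from those of
    [levi] and [bsym]. *)
Definition upper i j : E :=
  locked (t *: bsym i j + \sum_l bsym j l * levi i l).

Lemma leviE i j : levi i j = (t%:A) *+ (i == j) - \sum_k bsym i k * asym k j.
Proof. by rewrite /levi -lock. Qed.

Lemma upperE i j : upper i j = t *: bsym i j + \sum_l bsym j l * levi i l.
Proof. by rewrite /upper -lock. Qed.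

Lemma sum_bsym_asym i j : \sum_k bsym i k * asym k j =
  t%:A *+ (i == j) - levi i j.
Proof. by rewrite leviE opprB addrC subrK. Qed.

Lemma comm_algMn a n (x : E) : comm ((a%:A : E) *+ n) x = 0.
Proof. by rewrite -scaler_nat commZl comm_algl scaler0. Qed.

Lemma comm_levi_asym i j k l :
  comm (levi i j) (asym k l) = asym l j *+ (k == i) + asym k j *+ (l == i).
Proof.
rewrite leviE commBl comm_algMn sub0r comm_suml -sumrN.
rewrite -(sum_deltar (fun m => asym m j *+ (k == i)) l).
rewrite -(sum_deltar (fun m => asym m j *+ (l == i)) k) -big_split /=.
apply: eq_bigr => m _; rewrite commMl comm_asym mulr0 add0r -mulNr -commC
  comm_asym_bsym.
by rewrite mulrDl !mulrnAl mul1r -[X in _ + X]mulrnAC.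
Qed.

Lemma comm_levi_bsym i j k l :
  comm (levi i j) (bsym k l) = - (bsym i k *+ (j == l) + bsym i l *+ (j == k)).
Proof.
rewrite leviE commBl comm_algMn sub0r comm_suml; congr (- _).
rewrite -(sum_deltal (fun m => bsym i m *+ (j == l)) k).
rewrite -(sum_deltal (fun m => bsym i m *+ (j == k)) l) -big_split /=.
apply: eq_bigr => m _; rewrite commMl comm_bsym mul0r addr0 comm_asym_bsym.
by rewrite mulrDr !mulrnAr mulr1 ![_ *+ (m == _) *+ _]mulrnAC.
Qed.

Lemma comm_levi_levi i j k l :
  comm (levi i j) (levi k l) = levi k j *+ (i == l) - levi i l *+ (j == k).
Proof.
rewrite [levi k l]leviE commBr [comm _ (_ *+ _)]commC comm_algMn oppr0 sub0r.
rewrite comm_sumr.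
under eq_bigr do rewrite commMr comm_levi_bsym comm_levi_asym mulNr mulrDl
  mulrDr
  !mulrnAl !mulrnAr.
rewrite big_split sumrN !big_split /= sum_deltar sum_deltal !sumrMnl
  !sum_bsym_asym.
rewrite (bsymC k i) (asymC l j) opprD opprK opprD addrACA subrr add0r.
rewrite !mulrnBl [l == i]eq_sym [k == j]eq_sym mulrnAC opprB addrC addrA.
by rewrite subrK.
Qed.

Lemma comm_asym_upper a b i j : comm (asym a b) (upper i j) =
  levi i b *+ (a == j) + levi i a *+ (b == j)
  + levi j b *+ (a == i) + levi j a *+ (b == i).
Proof.
rewrite upperE commDr commZr comm_asym_bsym comm_sumr.
under eq_bigr => l _.
  rewrite commMr comm_asym_bsym [comm _ (levi _ _)]commC comm_levi_asym mulrDl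
    !mulrnAl mul1r.
  rewrite mulrN mulrDr !mulrnAr -[X in _ + X + _]mulrnAC (asymC b) (asymC a).
  over.
rewrite /= big_split sumrN !big_split /=.
rewrite (sum_deltar (fun k => levi i k *+ (a == j)) b).
rewrite (sum_deltar (fun k => levi i k *+ (b == j)) a) !sumrMnl !sum_bsym_asym.
rewrite !mulrnBl opprD !opprB [j == b]eq_sym [j == a]eq_sym.
rewrite scalerDr -!scalerMnr [X in _ + (_ + X)]addrACA -opprD 
  [t%:A *+ (b == j) *+ _]mulrnAC.
by rewrite [X in _ + X]addrA addrC addNKr addrA.
Qed.

(** The normally ordered form, from which the symmetry of [upper] is visible. *)
Lemma upper_expand k l :
  upper k l = (t *+ 2) *: bsym k l
    - \sum_m \sum_n bsym l m * bsym k n * asym n m.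
Proof.
rewrite upperE.
under eq_bigr do rewrite leviE mulrBr mulrnAr -scalerAr mulr1 mulr_sumr.
rewrite sumrB sum_deltar bsymC addrA -scalerDl -mulr2n; congr (_ - _).
by apply: eq_bigr => m _; apply: eq_bigr => n _; rewrite mulrA.
Qed.

Lemma upperC i j : upper i j = upper j i.
Proof.
rewrite !upper_expand bsymC; congr (_ - _); rewrite exchange_big /=.
apply: eq_bigr => m _; apply: eq_bigr => n _; rewrite (asymC n).
by congr (_ * _); apply/eqP; rewrite -subr_eq0; apply/eqP; exact: comm_bsym.
Qed.

Lemma comm_levi_upper i j k l :
  comm (levi i j) (upper k l) =
  - (upper i k *+ (j == l)) - upper i l *+ (j == k).
Proof.
rewrite [upper k l]upperE commDr commZr comm_levi_bsym comm_sumr.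
under eq_bigr => m _.
  rewrite commMr comm_levi_bsym comm_levi_levi mulNr mulrDl mulrBr !mulrnAl
    !mulrnAr.
  over.
rewrite /= big_split /= sumrN sumrB !big_split /= sum_deltar.
rewrite sum_deltar !sumrMnl.
rewrite (bsymC l i) [X in _ + (X + _)]opprD [X in _ + X]addrACA addNr add0r
  scalerN scalerDr.
rewrite -!scalerMnr -!opprD addrACA [upper i k]upperC !upperE !mulrnDl.
by rewrite (bsymC k i).
Qed.

Lemma comm_upper_bsym k l i j :
  comm (upper k l) (bsym i j) = - (bsym l j * bsym k i + bsym l i * bsym k j).
Proof.
rewrite upperE commDl commZl comm_bsym scaler0 add0r comm_suml.
under eq_bigr do rewrite commMl comm_bsym mul0r addr0 comm_levi_bsym mulrN
  mulrDr !mulrnAr.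
by rewrite sumrN big_split /= !sum_deltal.
Qed.

Lemma comm_upper_upper i j k l : comm (upper k l) (upper i j) = 0.
Proof.
rewrite [upper i j]upperE commDr commZr comm_upper_bsym comm_sumr.
under eq_bigr => m _.
  rewrite commMr comm_upper_bsym [comm _ (levi _ _)]commC comm_levi_upper
    mulNr opprD !opprK.
  rewrite mulrDl mulrDr !mulrnAr.
  over.
rewrite /= big_split sumrN !big_split /= sum_deltal sum_deltal.
have bb a b c d : bsym a b * bsym c d = bsym c d * bsym a b.
  by apply/eqP; rewrite -subr_eq0; apply/eqP; exact: comm_bsym.
rewrite [upper i k]upperE [upper i l]upperE ![bsym j _]bsymC !mulrDr
  -!scalerAr !mulr_sumr.
have -> : \sum_m bsym l m * bsym k j * levi i m =
  \sum_m bsym k j * (bsym l m * levi i m).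
  by apply: eq_bigr => m _; rewrite (bb l) -mulrA.
have -> : \sum_m bsym l j * bsym k m * levi i m =
  \sum_m bsym l j * (bsym k m * levi i m).
  by apply: eq_bigr => m _; rewrite -mulrA.
rewrite (bb k j) (bsymC i k) (bsymC i l) [X in - _ + X]addrACA scalerN scalerDr.
by rewrite [X in - X + _]addrC [X in - _ + X]addrC addKr addNr.
Qed.

End OscillatorRealization.

(** The generators are now arranged into one symmetric matrix indexed by labels:
    [(i, false)] stands for [i] and [(i, true)] for [i'].  Thus sp_2r is seen
    as the symmetric square of its vector representation, for which all
    brackets take the same form in terms of the symplectic form [sform]. *)
Section BracketForm.
Context (K : comNzRingType) (E : algType K) (r : nat).
Implicit Types p q k l : 'I_r * bool.

Definition sform p q : K := (p.1 == q.1)%:R * (q.2%:R - p.2%:R).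

Lemma sformC p q : sform q p = - sform p q.
Proof. by rewrite /sform eq_sym -mulrN opprB. Qed.

Definition sp_bracket (X : 'I_r * bool -> 'I_r * bool -> E) p q k l : E :=
  sform q k *: X p l + sform p k *: X q l
  + sform q l *: X p k + sform p l *: X q k.

End BracketForm.

Section SymplecticBrackets.
Context (K : comNzRingType) (E : algType K) (r : nat).
Context (asym levi upper : 'I_r -> 'I_r -> E).
Hypothesis asymC : forall i j, asym i j = asym j i.
Hypothesis upperC : forall i j, upper i j = upper j i.
Hypothesis comm_asym : forall i j k l, comm (asym i j) (asym k l) = 0.
Hypothesis comm_levi_asym : forall i j k l,
  comm (levi i j) (asym k l) = asym l j *+ (k == i) + asym k j *+ (l == i).
Hypothesis comm_levi_levi : forall i j k l,
  comm (levi i j) (levi k l) = levi k j *+ (i == l) - levi i l *+ (j == k).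
Hypothesis comm_asym_upper : forall a b i j, comm (asym a b) (upper i j) =
  levi i b *+ (a == j) + levi i a *+ (b == j)
  + levi j b *+ (a == i) + levi j a *+ (b == i).
Hypothesis comm_levi_upper : forall i j k l,
  comm (levi i j) (upper k l) =
  - (upper i k *+ (j == l)) - upper i l *+ (j == k).
Hypothesis comm_upper_upper : forall i j k l, comm (upper k l) (upper i j) = 0.

Definition sp_gen (p q : 'I_r * bool) : E :=
  match p.2, q.2 with
  | false, false => upper p.1 q.1
  | true, true => - asym p.1 q.1
  | false, true => levi p.1 q.1
  | true, false => levi q.1 p.1
  end.

Lemma sp_genC p q : sp_gen p q = sp_gen q p.
Proof.
by case: p q => i [] [j []]; rewrite /sp_gen //= ?(asymC i) ?(upperC i).
Qed.

Local Notation sform := (@sform K r).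
Local Notation bracket := (sp_bracket sp_gen).

Lemma sp_bracket_swapl p q k l : bracket q p k l = bracket p q k l.
Proof.
by rewrite /sp_bracket [X in X + _ + _]addrC -!addrA; congr (_ + (_ + _));
  rewrite addrC.
Qed.

Lemma sp_bracket_swapr p q k l : bracket p q l k = bracket p q k l.
Proof. by rewrite /sp_bracket -addrA addrC addrA. Qed.

Lemma sp_bracket_anti p q k l : bracket k l p q = - bracket p q k l.
Proof.
rewrite /sp_bracket ![sform _ p]sformC ![sform _ q]sformC !scaleNr -!opprD.
congr (- _).
rewrite (sp_genC k) (sp_genC l) (sp_genC k) (sp_genC l) -!addrA.
rewrite [LHS]addrCA [RHS]addrCA; congr (_ + _).
by rewrite [LHS]addrCA [RHS]addrCA; congr (_ + _); rewrite addrC.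
Qed.

(** The bracket has the symmetries of the left-hand side, so of the sixteen
    combinations of blocks only six have to be compared. *)
Lemma comm_sp_gen p q k l : comm (sp_gen p q) (sp_gen k l) = bracket p q k l.
Proof.
have om0 i j b x : sform (i, b) (j, b) *: x = 0 :> E.
  by rewrite /sform subrr mulr0 scale0r.
have omp i j x : sform (i, false) (j, true) *: x = x *+ (i == j) :> E.
  by rewrite /sform /= subr0 mulr1 scaler_nat.
have omn i j x : sform (i, true) (j, false) *: x = - x *+ (i == j) :> E.
  by rewrite /sform /= sub0r mulrN1 scaleNr scaler_nat mulNrn.
have PP i j k' l' :
    comm (sp_gen (i, false) (j, false))
      (sp_gen (k', false) (l', false)) =
    bracket (i, false) (j, false) (k', false) (l', false).
  by rewrite /sp_bracket !om0 !addr0; exact: comm_upper_upper.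
have AA i j k' l' :
    comm (sp_gen (i, true) (j, true))
      (sp_gen (k', true) (l', true)) =
    bracket (i, true) (j, true) (k', true) (l', true).
  by rewrite /sp_bracket !om0 !addr0 /sp_gen /= commNl commNr comm_asym !oppr0.
have HP i j k' l' :
    comm (sp_gen (i, false) (j, true))
      (sp_gen (k', false) (l', false)) =
    bracket (i, false) (j, true) (k', false) (l', false).
  rewrite /sp_bracket !om0 !omn /sp_gen /= comm_levi_upper !addr0 !mulNrn.
  by rewrite addrC.
have HA i j k' l' :
    comm (sp_gen (i, false) (j, true))
      (sp_gen (k', true) (l', true)) =
    bracket (i, false) (j, true) (k', true) (l', true).
  rewrite /sp_bracket !om0 !omp /sp_gen /= commNr comm_levi_asym !add0r addr0
    opprD.
  by rewrite (asymC l' j) (asymC k' j) !mulNrn [i == k']eq_sym [i == l']eq_sym.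
have AP i j k' l' :
    comm (sp_gen (i, true) (j, true))
      (sp_gen (k', false) (l', false)) =
    bracket (i, true) (j, true) (k', false) (l', false).
  rewrite /sp_bracket !omn /sp_gen /= commNl comm_asym_upper !mulNrn -!opprD;
    congr (- _).
  rewrite [LHS]addrC [X in _ + X]addrC [X in _ + (_ + X)]addrC.
  by rewrite !addrA.
have HH i j k' l' :
    comm (sp_gen (i, false) (j, true))
      (sp_gen (k', false) (l', true)) =
    bracket (i, false) (j, true) (k', false) (l', true).
  rewrite /sp_bracket !om0 !omn !omp /sp_gen /= comm_levi_levi !addr0 mulNrn.
  by rewrite addrC.
have anti p' q' k' l' :
    comm (sp_gen p' q') (sp_gen k' l') = bracket p' q' k' l' ->
    comm (sp_gen k' l') (sp_gen p' q') = bracket k' l' p' q'.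
  by move=> h; rewrite commC h -sp_bracket_anti.
have swl p' q' k' l' :
    comm (sp_gen p' q') (sp_gen k' l') = bracket p' q' k' l' ->
    comm (sp_gen q' p') (sp_gen k' l') = bracket q' p' k' l'.
  by move=> h; rewrite (sp_genC q' p') h -sp_bracket_swapl.
have swr p' q' k' l' :
    comm (sp_gen p' q') (sp_gen k' l') = bracket p' q' k' l' ->
    comm (sp_gen p' q') (sp_gen l' k') = bracket p' q' l' k'.
  by move=> h; rewrite (sp_genC l' k') h -sp_bracket_swapr.
case: p q k l => i [] [j []] [k' []] [l' []].
- exact: AA.
- exact/anti/swl/HA.
- exact/anti/HA.
- exact: AP.
- exact/swl/HA.
- exact/swl/swr/HH.
- exact/swl/HH.
- exact/swl/HP.
- exact: HA.
- exact/swr/HH.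
- exact: HH.
- exact: HP.
- exact/anti/AP.
- exact/anti/swl/HP.
- exact/anti/HP.
- exact: PP.
Qed.

End SymplecticBrackets.

Section CartanWeights.
Context (K : comNzRingType) (E : algType K) (r : nat).
Context (X : 'I_r * bool -> 'I_r * bool -> E).
Hypothesis XC : forall p q, X p q = X q p.
Hypothesis comm_X : forall p q k l, comm (X p q) (X k l) = sp_bracket X p q k l.

(** Negative on unprimed labels, since the entry [(i, j)] of the Lax matrix is
    the generator [F_ji] and not [F_ij]. *)
Definition weight (k : 'I_r) (p : 'I_r * bool) : K :=
  (p.1 == k)%:R * (if p.2 then 1 else - 1).

Lemma comm_cartan k p q :
  comm (X (k, false) (k, true)) (X p q) = (weight k p + weight k q) *: X p q.
Proof.
have half i x : sform K (k, true) i *: X (k, false) x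
    + sform K (k, false) i *: X (k, true) x = weight k i *: X i x.
  case: i => i b; rewrite /sform /weight /= [k == i]eq_sym.
  case: (eqVneq i k) => [->|_]; last by rewrite !mul0r !scale0r addr0.
  by case: b => /=; rewrite !mul1r ?subrr ?subr0 ?sub0r scale0r ?add0r ?addr0.
rewrite comm_X /sp_bracket half -addrA half scalerDl; congr (_ + _).
by rewrite XC.
Qed.

End CartanWeights.

(** * Entries of the Lax matrix *)

Definition flip (r : nat) (p : 'I_r * bool) : 'I_r * bool := (p.1, ~~ p.2).

Definition prime_sign (K : pzRingType) (r : nat) (p : 'I_r * bool) : K :=
  (-1) ^+ p.2.

Definition entry_index (r : nat) (p : 'I_r * bool) : 'I_(r + r) :=
  if p.2 then rev_ord (lshift r p.1) else lshift r p.1.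

Definition label (r : nat) (i : 'I_(r + r)) : 'I_r * bool :=
  match fintype.split i with
  | inl j => (j, false)
  | inr j => (rev_ord j, true)
  end.

Lemma entry_index_primed r (i : 'I_r) :
  entry_index (i, true) = rshift r (rev_ord i).
Proof. by apply: val_inj; rewrite /= addnBA. Qed.

Lemma labelK r : cancel (@label r) (@entry_index r).
Proof.
move=> i; rewrite /label; case: fintype.splitP => j ij; apply/val_inj.
  exact: esym.
by rewrite entry_index_primed rev_ordK; exact: esym.
Qed.

Lemma entry_indexK r : cancel (@entry_index r) (@label r).
Proof.
case=> i []; rewrite ?entry_index_primed /label /entry_index /=.
  by rewrite (unsplitK (inr (rev_ord i) : 'I_r + 'I_r)) rev_ordK.
by rewrite (unsplitK (inl i : 'I_r + 'I_r)).
Qed.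

Section LaxEntries.
Context (K : comNzRingType) (E : algType K) (r : nat).
Context (b d : 'I_r -> 'I_r -> E) (t x : K).
Hypothesis dd : forall i j k l : 'I_r, (i <= j)%N -> (k <= l)%N ->
  comm (d j i) (d l k) = 0.
Hypothesis bb : forall i j k l : 'I_r, (i <= j)%N -> (k <= l)%N ->
  comm (b i j) (b k l) = 0.
Hypothesis db : forall i j k l : 'I_r, (i <= j)%N -> (k <= l)%N ->
  comm (d j i) (b k l) = 1 *+ ((i == k) && (j == l)).

(** The entries of the matrices [A] and [Abar], with both indices unprimed.
    Extended to all pairs by symmetry, the generators [b i j] and [d j i] with
    [i <= j] satisfy relations without case distinctions; the factor 2 on the
    diagonal of [bsym] makes [comm_asym_bsym] uniform. *)
Definition asym (i j : 'I_r) : E := if (i <= j)%N then d j i else d i j.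

Definition bsym (i j : 'I_r) : E :=
  if (i < j)%N then b i j else if i == j then 2%:R * b i i else b j i.

Lemma asymC i j : asym i j = asym j i.
Proof. by rewrite /asym; case: ltngtP => // e; rewrite (val_inj e). Qed.

Lemma bsymC i j : bsym i j = bsym j i.
Proof.
by rewrite /bsym -!(inj_eq val_inj) /=; case: ltngtP => // e;
  rewrite (val_inj e).
Qed.

Lemma asym_leq (i j : 'I_r) : (i <= j)%N -> asym i j = d j i.
Proof. by rewrite /asym => ->. Qed.

Lemma bsym_leq (i j : 'I_r) : (i <= j)%N -> bsym i j = b i j *+ (i == j).+1.
Proof.
rewrite /bsym leq_eqVlt => /orP[/eqP e|ij].
  by rewrite (val_inj e) ltnn eqxx mulr_natl.
by rewrite ij -val_eqE /= ltn_eqF.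
Qed.

Lemma comm_asym i j k l : comm (asym i j) (asym k l) = 0.
Proof.
wlog ij : i j / (i <= j)%N => [h|].
  by case: (leqP i j) => [|/ltnW] ij; [|rewrite asymC]; exact: h.
wlog kl : k l / (k <= l)%N => [h|].
  by case: (leqP k l) => [|/ltnW] kl; [|rewrite (asymC k)]; exact: h.
by rewrite !asym_leq // dd.
Qed.

Lemma commMnr (y z : E) n : comm y (z *+ n) = comm y z *+ n.
Proof. by rewrite -scaler_nat commZr scaler_nat. Qed.

Lemma commMnl (y z : E) n : comm (y *+ n) z = comm y z *+ n.
Proof. by rewrite -scaler_nat commZl scaler_nat. Qed.

Lemma comm_bsym i j k l : comm (bsym i j) (bsym k l) = 0.
Proof.
wlog ij : i j / (i <= j)%N => [h|].
  by case: (leqP i j) => [|/ltnW] ij; [|rewrite bsymC]; exact: h.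
wlog kl : k l / (k <= l)%N => [h|].
  by case: (leqP k l) => [|/ltnW] kl; [|rewrite (bsymC k)]; exact: h.
by rewrite !bsym_leq // commMnr commMnl bb // !mul0rn.
Qed.

Lemma comm_asym_bsym i j k l : comm (asym i j) (bsym k l) =
  1 *+ (i == k) *+ (j == l) + 1 *+ (i == l) *+ (j == k).
Proof.
wlog ij : i j / (i <= j)%N => [h|].
  case: (leqP i j) => [|/ltnW] ij; [|rewrite asymC]; rewrite h //.
  by rewrite addrC mulrnAC; congr (_ + _); rewrite mulrnAC.
wlog kl : k l / (k <= l)%N => [h|].
  case: (leqP k l) => [|/ltnW] kl; [|rewrite (bsymC k)]; rewrite h //.
  by rewrite addrC.
rewrite asym_leq // bsym_leq // commMnr db //.
have [->|ik] := eqVneq i k; have [->|jl] := eqVneq j l => /=;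
  rewrite ?mulr0n ?mul0rn ?mulr1n ?add0r.
- by rewrite [l == k]eq_sym; case: (k == l); rewrite /= ?mulr1n ?mulr0n ?addr0.
- case: (eqVneq k l) => [e|]; last by rewrite mul0rn.
  case: eqVneq => [e'|]; last by rewrite mulr0n.
  by rewrite e' e eqxx in jl.
- case: (eqVneq i l) => [e|]; last by rewrite !mul0rn.
  case: eqVneq => [e'|]; last by rewrite !mulr0n.
  by rewrite e e' eqxx in ik.
- case: (eqVneq i l) => [e|]; last by rewrite !mul0rn.
  case: eqVneq => [e'|]; last by rewrite !mulr0n.
  have : i = j by apply/val_inj/eqP; rewrite eqn_leq ij /= e e'.
  by move=> ij'; rewrite -ij' e eqxx in jl.
Qed.

Lemma Abar_mxE i j : Abar_mx b i (rev_ord j) = bsym i j.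
Proof. by rewrite mxE rev_ordK. Qed.

Lemma A_mxE i j : A_mx d (rev_ord j) i = asym i j.
Proof. by rewrite mxE rev_ordK /asym. Qed.

(** Normal ordering of the product [A Abar]; this is the origin of the constant
    [r + 1] in the Lax matrix. *)
Lemma sum_asym_bsym i j :
  \sum_k asym k i * bsym k j =
  \sum_k bsym k j * asym k i + (r%:R + 1) *+ (i == j).
Proof.
have -> : \sum_k asym k i * bsym k j =
  \sum_k (bsym k j * asym k i + comm (asym k i) (bsym k j)).
  by apply: eq_bigr => k _; rewrite /comm addrC subrK.
rewrite big_split /=; congr (_ + _).
under eq_bigr do rewrite comm_asym_bsym eqxx.
rewrite big_split /= (sum_deltar (fun k => 1 *+ (k == j))) sumr_const card_ord.
by rewrite mulr1n mulrnAC -mulrnDl.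
Qed.

Definition osc_gen := sp_gen asym (levi asym bsym t) (upper asym bsym t).

Lemma lax_entry p q : lax b d t x (entry_index p) (entry_index q) =
  x%:A *+ (p == q) + prime_sign K q *: osc_gen p (flip q).
Proof.
have revE (i j : 'I_r) : (rev_ord i == rev_ord j) = (i == j).
  exact: (inj_eq rev_ord_inj).
have dE (i j : 'I_r) (c c' : bool) :
  ((i, c) == (j, c')) = (i == j) && (c == c') by [].
have natA : (r%:R + 1 : E) = (r%:R + 1 : K)%:A.
  by rewrite scalerDl scaler_nat scale1r.
have AAbar (i j : 'I_r) :
    \sum_k A_mx d (rev_ord i) k * Abar_mx b k (rev_ord j)
    = \sum_k bsym k j * asym k i + (r%:R + 1 : K)%:A *+ (i == j).
  rewrite -natA -sum_asym_bsym; apply: eq_bigr => k _.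
  by rewrite A_mxE Abar_mxE (asymC k).
case: p q => i [] [j []]; rewrite ?entry_index_primed /entry_index /= /lax
  ?block_mxEul ?block_mxEur ?block_mxEdl ?block_mxEdr dE ?andbT ?andbF
  /osc_gen /prime_sign /flip /sp_gen /= ?expr0 ?expr1 ?scaleN1r ?scale1r
    ?mulr0n ?add0r.
- rewrite 3!mxE revE AAbar leviE opprB [j == i]eq_sym addrCA addrC.
  rewrite -mulrnDl -scalerDl [RHS]addrCA [RHS]addrC; congr (_ + _); last first.
    by apply: eq_bigr => k _; rewrite bsymC.
  by rewrite -mulrnBl -scalerBl -[_ - r%:R - 1]addrA -opprD subrK.
- by rewrite mxE A_mxE asymC.
- rewrite mxE; congr (- _); rewrite mxE (reindex_inj rev_ord_inj) /=.
  rewrite upper_expand; last exact: bsymC.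
  under eq_bigr => k _.
    rewrite Abar_mxE !mxE revE AAbar opprD addrA addrAC.
    rewrite -mulrnBl -scalerBl -[2 * t + _ + _]addrA addrK mulrDr mulrN
      mulrnAr -scalerAr mulr1 mulr_sumr.
    over.
  rewrite /= sumrB sum_deltal mulr_natl; congr (_ - _).
  rewrite exchange_big /=; apply: eq_bigr => m _; apply: eq_bigr => n _.
  rewrite mulrA (bsymC m) (asymC n); congr (_ * _).
  by apply/eqP; rewrite -subr_eq0; apply/eqP; exact: comm_bsym.
- rewrite 4!mxE leviE scalerDl mulrnDl -addrA; congr (_ + (_ - _)).
  by rewrite (reindex_inj rev_ord_inj); apply: eq_bigr => k _;
    rewrite Abar_mxE A_mxE asymC.
Qed.

Lemma osc_genC p q : osc_gen p q = osc_gen q p.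
Proof.
by apply: sp_genC; [exact: asymC|exact: upperC asymC bsymC comm_bsym].
Qed.

Lemma comm_osc_gen p q k l :
  comm (osc_gen p q) (osc_gen k l) = sp_bracket osc_gen p q k l.
Proof.
apply: comm_sp_gen.
- exact: asymC.
- exact: upperC asymC bsymC comm_bsym.
- exact: comm_asym.
- exact: comm_levi_asym comm_asym comm_asym_bsym.
- exact: comm_levi_levi asymC bsymC comm_asym comm_bsym comm_asym_bsym.
- exact: comm_asym_upper asymC comm_asym comm_asym_bsym.
- exact: comm_levi_upper asymC bsymC comm_asym comm_bsym comm_asym_bsym.
- exact: comm_upper_upper asymC bsymC comm_asym comm_bsym comm_asym_bsym.
Qed.

Lemma osc_gen_cartan k :
  osc_gen (k, false) (k, true) = t%:A - \sum_m bsym k m * asym m k.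
Proof. by rewrite /osc_gen /sp_gen /= leviE eqxx. Qed.

Lemma comm_cartan_bsym k i j :
  comm (osc_gen (k, false) (k, true)) (bsym i j) =
    - ((i == k) + (j == k))%:R *: bsym i j.
Proof.
rewrite /osc_gen /sp_gen /= (comm_levi_bsym _ comm_bsym comm_asym_bsym) //
  natrD scaleNr scalerDl !scaler_nat.
rewrite ![k == _]eq_sym addrC; congr (- (_ + _)).
  by case: eqP => [->|_]; rewrite ?mulr0n ?(bsymC k).
by case: eqP => [->|_]; rewrite ?mulr0n ?(bsymC k).
Qed.

Lemma comm_cartan_asym k i j :
  comm (osc_gen (k, false) (k, true)) (asym i j) =
    ((i == k) + (j == k))%:R *: asym i j.
Proof.
rewrite /osc_gen /sp_gen /= (comm_levi_asym _ comm_asym comm_asym_bsym) natrD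
  scalerDl !scaler_nat.
congr (_ + _); case: eqP => [->|_]; rewrite ?mulr0n //.
by rewrite asymC.
Qed.

End LaxEntries.

(** * Conjugation by signed permutations *)

Section SignedPermutations.
Context (r : nat).
Implicit Types (mu nu : 'I_r -> bool) (p q : 'I_r * bool).

Definition flip_at mu p : 'I_r * bool := (p.1, p.2 (+) mu p.1).

Definition sign_at (K : pzRingType) mu p : K := (-1) ^+ (mu p.1 && p.2).

Lemma flip_atK mu : involutive (flip_at mu).
Proof. by case=> i b; rewrite /flip_at /= addbK. Qed.

Lemma flip_flip_at mu p : flip (flip_at mu p) = flip_at mu (flip p).
Proof. by case: p => i b; rewrite /flip_at /flip /= addNb. Qed.

Lemma sign_atM (K : comPzRingType) mu p : sign_at K mu p * sign_at K mu p = 1.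
Proof. by rewrite /sign_at -expr2 sqrr_sign. Qed.

Lemma prime_sign_flip (K : comPzRingType) mu q :
  sign_at K mu q * prime_sign K (flip_at mu q) =
    sign_at K mu (flip q) * prime_sign K q.
Proof.
case: q => i b; rewrite /sign_at /prime_sign /flip_at /flip /= -!signr_addb.
by case: (mu i) b => [] [].
Qed.

(** The signed permutations are symplectic. *)
Lemma sform_flip (K : comNzRingType) mu p q :
  sign_at K mu p * sign_at K mu q * sform K (flip_at mu p) (flip_at mu q) =
    sform K p q.
Proof.
case: p q => i b [j c]; rewrite /sform /sign_at /flip_at /=.
case: (eqVneq i j) => [->|_]; last by rewrite !mul0r mulr0.
by case: (mu j) b c => [] [] []; rewrite /= ?expr0 ?expr1; ring.
Qed.

(** A symplectic change of labels preserves the brackets; hence the structure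
    constants are the same for all sign vectors. *)
Lemma comm_conj mu (K : comNzRingType) (E : algType K)
    (X : 'I_r * bool -> 'I_r * bool -> E) (Y := fun p q =>
      (sign_at K mu p * sign_at K mu q) *: X (flip_at mu p) (flip_at mu q)) :
  (forall p q k l, comm (X p q) (X k l) = sp_bracket X p q k l) ->
  forall p q k l, comm (Y p q) (Y k l) = sp_bracket Y p q k l.
Proof.
move=> h p q k l; rewrite /Y commZl commZr h /sp_bracket !scalerDr !scalerA.
rewrite -(sform_flip K mu q k) -(sform_flip K mu p k).
rewrite -(sform_flip K mu q l) -(sform_flip K mu p l).
by congr (_ *: _ + _ *: _ + _ *: _ + _ *: _); ring.
Qed.

Variable K : comUnitRingType.

Definition signed_perm mu : 'M[K]_(r + r) :=
  \matrix_(i, j)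
    (sign_at K mu (label i) * (label j == flip_at mu (label i))%:R).

Lemma sum_label (V : nmodType) (F : 'I_(r + r) -> V) p :
  \sum_i F i *+ (label i == p) = F (entry_index p).
Proof.
rewrite (bigD1 (entry_index p)) //= entry_indexK eqxx big1 ?addr0 // => i ip.
case: eqP => // e; by rewrite -e labelK eqxx in ip.
Qed.

Lemma signed_permM mu nu : (forall i, ~~ (mu i && nu i)) ->
  signed_perm mu *m signed_perm nu = signed_perm (fun i => mu i || nu i).
Proof.
move=> dis; apply/matrixP => i j; rewrite !mxE.
under eq_bigr do rewrite !mxE mulr_natr mulrnAl.
rewrite sum_label entry_indexK mulrA; congr (_ * _).
  rewrite /sign_at /flip_at /= -signr_addb; have := dis (label i).1.
  by case: (mu _) (nu _) (label i).2 => [] [] [].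
rewrite /flip_at /=; have := dis (label i).1.
by case: (mu _) (nu _) (label i).2 => [] [] [].
Qed.

Lemma signed_perm0 mu : (forall i, mu i = false) -> signed_perm mu = 1%:M.
Proof.
move=> mu0; apply/matrixP => i j; rewrite !mxE /sign_at /flip_at mu0 /= mul1r
  addbF -surjective_pairing.
by rewrite (inj_eq (can_inj (@labelK r))) eq_sym.
Qed.

Lemma invmx_signed_perm mu : invmx (signed_perm mu) = (signed_perm mu)^T.
Proof.
have h : signed_perm mu *m (signed_perm mu)^T = 1%:M.
  apply/matrixP => i j; rewrite !mxE.
  under eq_bigr do rewrite !mxE [sign_at K mu (label i) * _]mulr_natr mulrnAl.
  rewrite sum_label entry_indexK (inj_eq (inv_inj (flip_atK mu))).
  rewrite (inj_eq (can_inj (@labelK r))).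
  by case: eqP => [->|_]; rewrite ?mulr1 ?sign_atM ?mulr0.
have [u _] := mulmx1_unit h.
by rewrite -[LHS]mulmx1 -h mulKmx.
Qed.

Lemma conj_signed_perm (E : algType K) mu (L : 'M[E]_(r + r)) p q :
  (map_mx (in_alg E) (signed_perm mu) *m L
   *m map_mx (in_alg E) (invmx (signed_perm mu)))
    (entry_index p) (entry_index q)
  = (sign_at K mu p * sign_at K mu q)
    *: L (entry_index (flip_at mu p)) (entry_index (flip_at mu q)).
Proof.
rewrite invmx_signed_perm mxE.
under eq_bigr do rewrite [map_mx _ _ _ (entry_index q)]mxE [X in in_alg E X]mxE
  [X in in_alg E X]mxE entry_indexK mulr_natr raddfMn mulrnAr.
rewrite sum_label mxE.
under eq_bigr do rewrite [map_mx _ _ (entry_index p) _]mxE [X in in_alg E X]mxE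
  entry_indexK mulr_natr raddfMn mulrnAl.
by rewrite sum_label /= -scalerAl mul1r -scalerAr mulr1 scalerA mulrC.
Qed.

End SignedPermutations.

Section BMatrices.
Context (R : realType) (r : nat).
Local Notation C := R[i].

Lemma B_mxE (i : 'I_r) : B_mx R i = signed_perm C (fun j => j == i).
Proof.
apply/matrixP => k l; rewrite -(labelK k) -(labelK l).
move: (label k) (label l) => [k' b] [l' c].
have posE (c1 c2 : bool) (i1 i2 : 'I_r) :
    (entry_index (i1, c1) == entry_index (i2, c2)) = (i1 == i2) && (c1 == c2).
  exact: (inj_eq (can_inj (@entry_indexK r))).
pose e p q : 'M[C]_(r + r) := delta_mx (@entry_index r p) (entry_index q).
have -> : B_mx R i = e (i, false) (i, true) - e (i, true) (i, false)
    + \sum_(j < r | j != i) (e (j, false) (j, false) + e (j, true) (j, true)).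
  by [].
rewrite !mxE !entry_indexK summxE !posE /sign_at /flip_at /=
  [(l', c) == _]xpair_eqE.
under eq_bigr do rewrite !mxE !posE.
have [->|ki] := eqVneq k' i.
  rewrite big1 => [|j ji]; last by rewrite [i == j]eq_sym (negPf ji) addr0.
  rewrite /= addr0 ?addbT.
  by case: (l' == i) b c => [] [] []; rewrite /= ?mulr0 ?mulr1 ?subr0 ?sub0r
    ?subrr.
rewrite (bigD1 k') //= big1 => [|j /andP[_ jk]]; last first.
  by rewrite [k' == j]eq_sym (negPf jk) addr0.
rewrite eqxx subrr add0r addr0 addbF mul1r /=.
by case: (l' == k') b c => [] [] []; rewrite /= ?addr0 ?add0r.
Qed.

(** The factors [B_mx j] flip distinct pairs of labels, so their product is the
    signed permutation that performs all the flips. *)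
Lemma Bmu_mxE (mu : {ffun 'I_r -> bool}) : Bmu_mx R mu = signed_perm C mu.
Proof.
rewrite /Bmu_mx.
suff h (l : seq 'I_r) : uniq l -> \prod_(j <- l | mu j) B_mx R j
    = signed_perm C (fun j => mu j && (j \in l)).
  rewrite h ?index_enum_uniq //; congr signed_perm; apply/funext => j.
  by rewrite mem_index_enum andbT.
elim: l => [_|j l IH /= /andP[jl ul]].
  by rewrite big_nil signed_perm0 // => i; rewrite andbF.
rewrite big_cons IH //; case: ifP => muj; last first.
  congr signed_perm; apply/funext => i; rewrite in_cons.
  by case: eqP => [->|//]; rewrite muj.
rewrite B_mxE [_ * _]signed_permM => [|i]; last first.
  by case: eqP => [->|//]; rewrite (negPf jl) andbF.
congr signed_perm; apply/funext => i; rewrite in_cons.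
by case: eqP => [->|//]; rewrite muj.
Qed.

End BMatrices.

(** * The realization attached to a sign vector *)

Section Realization.
Context (R : realType) (r : nat).
Local Notation C := R[i].
Local Notation E := (endo R r).
Local Notation M := (multinom #|{: osc r}|).

Definition osc_of (i j : 'I_r) (ij : (i <= j)%N) : osc r := exist _ (i, j) ij.

Lemma osc_ofE (i j k l : 'I_r) (ij : (i <= j)%N) (kl : (k <= l)%N) :
  (osc_of ij == osc_of kl) = (i == k) && (j == l).
Proof. by rewrite -(inj_eq val_inj). Qed.

Lemma abar_osc (i j : 'I_r) (ij : (i <= j)%N) : abar R i j =
  creation R (osc_of ij).
Proof. by rewrite /abar insubT. Qed.

Lemma a_osc (i j : 'I_r) (ij : (i <= j)%N) : a R j i =
  annihilation R (osc_of ij).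
Proof. by rewrite /a insubT. Qed.

Lemma comm_creation (p q : osc r) : comm (creation R p) (creation R q) = 0.
Proof.
apply/eqP; rewrite subr_eq0; apply/eqP/endoP => v.
by rewrite !endoM /creation /= mulrCA.
Qed.

Lemma comm_annihilation (p q : osc r) :
  comm (annihilation R p) (annihilation R q) = 0.
Proof.
apply/eqP; rewrite subr_eq0; apply/eqP/endoP => v.
by rewrite !endoM /annihilation /= mderiv_comm.
Qed.

Lemma comm_annihilation_creation (p q : osc r) :
  comm (annihilation R p) (creation R q) = (p == q)%:R.
Proof. exact: ccr. Qed.

Lemma comm_creation_annihilation (p q : osc r) :
  comm (creation R p) (annihilation R q) = - (p == q)%:R.
Proof. by rewrite commC comm_annihilation_creation eq_sym. Qed.

Section Sign.
Variable mu : {ffun 'I_r -> bool}.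

Let comm_osc := (comm_creation, comm_annihilation, comm_annihilation_creation,
  comm_creation_annihilation).

(** The substitution [abar -> - a], [a -> abar] preserves the canonical
    commutation relations, and oscillators with different first index commute
    whether or not it is applied to them. *)
Lemma a_mu_a_mu (i j k l : 'I_r) : (i <= j)%N -> (k <= l)%N ->
  comm (a_mu R mu j i) (a_mu R mu l k) = 0.
Proof.
move=> ij; rewrite /a_mu.
have [<- kl|ik kl] := eqVneq i k; first by case: (mu i);
  rewrite /= ?(abar_osc ij) ?(a_osc ij) ?(abar_osc kl) ?(a_osc kl) !comm_osc.
by case: (mu i) (mu k) => [] [];
  rewrite /= ?(abar_osc ij) ?(a_osc ij) ?(abar_osc kl) ?(a_osc kl) !comm_osc
   ?osc_ofE ?(negPf ik) ?oppr0.
Qed.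

Lemma abar_mu_abar_mu (i j k l : 'I_r) : (i <= j)%N -> (k <= l)%N ->
  comm (abar_mu R mu i j) (abar_mu R mu k l) = 0.
Proof.
move=> ij; rewrite /abar_mu.
have [<- kl|ik kl] := eqVneq i k; first by case: (mu i);
  rewrite /= ?(abar_osc ij) ?(a_osc ij) ?(abar_osc kl) ?(a_osc kl) ?commNl
    ?commNr
  !comm_osc ?oppr0.
by case: (mu i) (mu k) => [] [];
  rewrite /= ?(abar_osc ij) ?(a_osc ij) ?(abar_osc kl) ?(a_osc kl) ?commNl
    ?commNr
  !comm_osc ?osc_ofE ?(negPf ik) ?oppr0.
Qed.

Lemma a_mu_abar_mu (i j k l : 'I_r) : (i <= j)%N -> (k <= l)%N ->
  comm (a_mu R mu j i) (abar_mu R mu k l) = 1 *+ ((i == k) && (j == l)).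
Proof.
move=> ij; rewrite /abar_mu /a_mu.
have [<- kl|ik kl] := eqVneq i k; first by case: (mu i);
  rewrite /= ?(abar_osc ij) ?(a_osc ij) ?(abar_osc kl) ?(a_osc kl) ?commNl
    ?commNr
  !comm_osc osc_ofE eqxx ?opprK.
by case: (mu i) (mu k) => [] [];
  rewrite /= ?(abar_osc ij) ?(a_osc ij) ?(abar_osc kl) ?(a_osc kl) ?commNl
    ?commNr
  !comm_osc ?osc_ofE ?(negPf ik) ?oppr0.
Qed.

Variable t : C.

Local Notation asym_mu := (asym (a_mu R mu)).
Local Notation bsym_mu := (bsym (abar_mu R mu)).
Local Notation gen0 := (osc_gen (abar_mu R mu) (a_mu R mu) t).

Definition gen_mu (p q : 'I_r * bool) : E :=
  locked ((sign_at C mu p * sign_at C mu q)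
          *: gen0 (flip_at mu p) (flip_at mu q)).

Lemma gen_muE p q : gen_mu p q =
  (sign_at C mu p * sign_at C mu q) *: gen0 (flip_at mu p) (flip_at mu q).
Proof. by rewrite /gen_mu -lock. Qed.

Lemma gen_muC p q : gen_mu p q = gen_mu q p.
Proof.
rewrite !gen_muE mulrC (osc_genC _ _ abar_mu_abar_mu) //.
Qed.

Lemma lax_mu_entry x p q : lax_mu mu t x (entry_index p) (entry_index q) =
  x%:A *+ (p == q) + prime_sign C q *: gen_mu p (flip q).
Proof.
rewrite /lax_mu Bmu_mxE conj_signed_perm.
rewrite (lax_entry _ _ abar_mu_abar_mu a_mu_abar_mu).
rewrite (inj_eq (inv_inj (flip_atK mu))) flip_flip_at scalerDr scalerA gen_muE
  scalerA.
congr (_ + _ *: _).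
  by case: eqP => [->|_]; rewrite ?mulr0n ?scaler0 // sign_atM scale1r.
by rewrite -mulrA prime_sign_flip mulrA mulrC.
Qed.

Lemma comm_gen_mu p q k l :
  comm (gen_mu p q) (gen_mu k l) = sp_bracket gen_mu p q k l.
Proof.
rewrite /sp_bracket !gen_muE; apply: (@comm_conj _ mu _ _ gen0).
exact: comm_osc_gen a_mu_a_mu abar_mu_abar_mu a_mu_abar_mu.
Qed.

Lemma comm_cartan_gen_mu k p q :
  comm (gen_mu (k, false) (k, true)) (gen_mu p q) =
    (weight C k p + weight C k q) *: gen_mu p q.
Proof. exact: (comm_cartan gen_muC comm_gen_mu). Qed.

Lemma gen_mu_cartan k : gen_mu (k, false) (k, true) =
  (-1) ^+ mu k *: gen0 (k, false) (k, true).
Proof.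
rewrite gen_muE /sign_at /flip_at /= andbF andbT mul1r.
by case: (mu k) => //=; rewrite (osc_genC _ _ abar_mu_abar_mu).
Qed.

Lemma cyclic_a_mu i j : cyclic (a_mu R mu j i).
Proof.
rewrite /a_mu /a /abar.
by case: (mu i); case: insubP => [p _ _|_];
  [exact: cyclic_creation|exact: cyclic0
  |exact: cyclic_annihilation|exact: cyclic0].
Qed.

Lemma cyclic_abar_mu i j : cyclic (abar_mu R mu i j).
Proof.
rewrite /abar_mu /a /abar.
by case: (mu i); case: insubP => [p _ _|_];
  [exact/cyclicN/cyclic_annihilation|exact/cyclicN/cyclic0
  |exact: cyclic_creation|exact: cyclic0].
Qed.

Lemma cyclicMn (Y : E) n : cyclic Y -> cyclic (Y *+ n).
Proof. by rewrite -scaler_nat; exact: cyclicZ. Qed.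

Lemma cyclic_asym i j : cyclic (asym_mu i j).
Proof. by rewrite /asym; case: ifP => _; exact: cyclic_a_mu. Qed.

Lemma cyclic_bsym i j : cyclic (bsym_mu i j).
Proof.
rewrite /bsym; case: ifP => _; first exact: cyclic_abar_mu.
by case: ifP => _; rewrite ?mulr_natl; [apply: cyclicMn|];
  exact: cyclic_abar_mu.
Qed.

Lemma cyclic_levi i j : cyclic (levi asym_mu bsym_mu t i j).
Proof.
rewrite leviE; apply: cyclicD; first by apply/cyclicMn/cyclicZ; exact: cyclic1.
apply/cyclicN/cyclic_sum => k _.
by apply: cyclicM; [exact: cyclic_bsym|exact: cyclic_asym].
Qed.

Lemma cyclic_upper i j : cyclic (upper asym_mu bsym_mu t i j).
Proof.
rewrite upperE; apply: cyclicD; first by apply: cyclicZ; exact: cyclic_bsym.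
by apply/cyclic_sum => k _; apply: cyclicM;
  [exact: cyclic_bsym|exact: cyclic_levi].
Qed.

Lemma cyclic_gen_mu p q : cyclic (gen_mu p q).
Proof.
rewrite gen_muE; apply: cyclicZ; rewrite /osc_gen /sp_gen; case: ifP => _;
  case: ifP => _.
- by apply: cyclicN; exact: cyclic_asym.
- exact: cyclic_levi.
- exact: cyclic_levi.
- exact: cyclic_upper.
Qed.

(** The creation operator of the oscillator [(i, j)] is an entry of [asym] if
    the substitution was applied to it, and proportional to an entry of [bsym]
    otherwise; the two have opposite weights. *)
Lemma comm_cartan_creation_osc (k i j : 'I_r) (ij : (i <= j)%N) :
  comm (gen_mu (k, false) (k, true)) (creation R (osc_of ij)) =
  - ((-1) ^+ mu k * (-1) ^+ mu i * ((i == k) + (j == k))%:R)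
    *: creation R (osc_of ij).
Proof.
rewrite gen_mu_cartan commZl; case mui : (mu i).
  have -> : creation R (osc_of ij) = asym_mu i j.
    by rewrite asym_leq // /a_mu mui (abar_osc ij).
  rewrite (comm_cartan_asym _ a_mu_a_mu a_mu_abar_mu) scalerA; congr (_ *: _).
  by rewrite expr1 mulrN1 mulNr opprK.
have -> : creation R (osc_of ij) = ((i == j).+1%:R : C)^-1 *: bsym_mu i j.
  rewrite bsym_leq // /abar_mu mui (abar_osc ij).
  by rewrite -[creation _ _ *+ _]scaler_nat scalerA mulVf ?scale1r.
rewrite commZr (comm_cartan_bsym _ abar_mu_abar_mu a_mu_abar_mu) !scalerA.
by congr (_ *: _); rewrite expr0 mulr1 mulrN mulNr mulrAC.
Qed.

End Sign.

End Realization.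

(** * Diagonal operators and the twist *)

Section ComplexExponential.
Context (R : realType).
Local Notation C := R[i].
Implicit Types z w : C.

Lemma cexpD z w : cexp (z + w) = cexp z * cexp w.
Proof.
case: z w => a b [c e]; rewrite /cexp /= expRD cosD sinD.
by apply/eqP; rewrite eq_complex /=; apply/andP; split; apply/eqP; ring.
Qed.

Lemma cexp0 : cexp (0 : C) = 1.
Proof.
rewrite /cexp /= expR0 cos0 sin0.
by apply/eqP; rewrite eq_complex /=; apply/andP; split; apply/eqP; ring.
Qed.

Lemma cexp_sum (I : Type) (l : seq I) (F : I -> C) :
  cexp (\sum_(i <- l) F i) = \prod_(i <- l) cexp (F i).
Proof. exact: (big_morph _ cexpD cexp0). Qed.

Lemma norm_cexp z : `|cexp z| = (expR (complex.Re z))%:C.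
Proof.
rewrite /cexp normrM !normc_def /= cos2Dsin2 sqrtr1 mulr1.
by rewrite expr0n addr0 sqrtr_sqr ger0_norm // expR_ge0.
Qed.

End ComplexExponential.

Section DiagonalOperators.
Context (R : realType) (r : nat).
Local Notation C := R[i].
Local Notation E := (endo R r).
Local Notation V := (fock R r).
Local Notation M := (multinom #|{: osc r}|).

Definition diagonal (X : E) (lam : M -> C) : Prop :=
  forall m : M, X (mpolyX C m : V) = lam m *: (mpolyX C m : V).

Lemma mcoeff_diagonal X lam : diagonal X lam ->
  forall m (p : V), mcoeff m (X p) = lam m * mcoeff m p.
Proof.
move=> dX m p; rewrite {1}[p]mpolyE linear_sum raddf_sum /=.
rewrite [in RHS](mpolyE p) raddf_sum mulr_sumr /=.
apply: eq_bigr => k _; rewrite linearZ /= dX !mcoeffZ mcoeffX.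
by case: eqP => [->|_]; [rewrite mulrCA|rewrite !mulr0].
Qed.

Lemma mel_diagonal_l X lam : diagonal X lam ->
  forall Y m' m, mel (X * Y) m' m = lam m' * mel Y m' m.
Proof. by move=> dX Y m' m; rewrite /mel endoM (mcoeff_diagonal dX). Qed.

Lemma mel_diagonal_r X lam : diagonal X lam ->
  forall Y m' m, mel (Y * X) m' m = lam m * mel Y m' m.
Proof. by move=> dX Y m' m; rewrite /mel endoM dX linearZ mcoeffZ. Qed.

Lemma diagonal_mel X lam : diagonal X lam -> lam = fun m => mel X m m.
Proof.
move=> dX; apply/funext => m.
by rewrite /mel dX mcoeffZ mcoeffX eqxx mulr1.
Qed.

Lemma melP (X Y : E) : (forall m' m, mel X m' m = mel Y m' m) -> X = Y.
Proof.
move=> h; apply: endoP => v; rewrite [v]mpolyE !linear_sum /=.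
apply: eq_bigr => m _; rewrite !linearZ /=; congr (_ *: _).
by apply/mpolyP => m'; exact: h.
Qed.

Lemma diagonal_weight X lam w Y : diagonal X lam -> comm X Y = w *: Y ->
  forall m' m, mel Y m' m != 0 -> lam m' = lam m + w.
Proof.
move=> dX h m' m Y0; apply: (mulIf Y0).
have := congr1 (fun Z => mel Z m' m) h.
rewrite melZ /comm melD -scaleN1r melZ (mel_diagonal_l dX) (mel_diagonal_r dX).
by rewrite mulrDl => <-; rewrite mulN1r addrC subrK.
Qed.

(** Monomials are obtained from the vacuum by creation operators, each of which
    shifts the eigenvalue of [X]. *)
Lemma diagonal_ind (X : E) (w : osc r -> C) :
  (exists c, X (1 : V) = c *: (1 : V)) ->
  (forall p, comm X (creation R p) = w p *: creation R p) ->
  exists lam, diagonal X lam.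
Proof.
move=> [c Xc] hw; exists (fun m => mel X m m).
suff h n (m : M) : mdeg m = n ->
    exists lam, X (mpolyX C m : V) = lam *: (mpolyX C m : V).
  move=> m; have [lam e] := h _ m erefl.
  by rewrite /mel e mcoeffZ mcoeffX eqxx mulr1.
elim: n m => [m /eqP|n IH m mn].
  by rewrite mdeg_eq0 => /eqP->; rewrite mpolyX0; exists c.
have [i [m0 m'n]] := mdegS_ex mn.
pose v : V := mpolyX C (mnm_sub m (mnm1 i)); have [lam e] := IH _ m'n.
have cE : mpolyX C m = creation R (enum_val i) v.
  by rewrite /creation /= enum_valK -mpolyXD addmC sub1mK.
exists (w (enum_val i) + lam); rewrite cE scalerDl.
have := congr1 (fun Y : E => Y v) (hw (enum_val i)).
rewrite endoZ => <-; rewrite /comm endoD -scaleN1r endoZ scaleN1r !endoM.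
by rewrite e linearZ subrK.
Qed.

Section Twist.
Context (xi : 'I_r -> C) (F : 'I_r -> E) (lam : 'I_r -> M -> C).
Hypothesis dF : forall k, diagonal (F k) (lam k).

Definition twist : E := \prod_(k < r) tau_pow (xi k) (F k).

Definition twist_eig (m : M) : C := cexp (\sum_k xi k * lam k m).

Lemma diagonal_twist : diagonal twist twist_eig.
Proof.
move=> m; rewrite /twist /twist_eig cexp_sum.
elim: (index_enum _) => [|k l IH]; first by rewrite !big_nil scale1r.
rewrite !big_cons endoM IH linearZ /= mulrC -scalerA; congr (_ *: _).
apply/mpolyP => m'; rewrite mcoeff_diag_op mcoeffZ mcoeffX.
case: eqP => [<-|_]; last by rewrite !mulr0.
by rewrite -/(mel (F k) m m) (diagonal_mel (dF k)).
Qed.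

Lemma twist_comm (w : 'I_r -> C) Y : (forall k, comm (F k) Y = w k *: Y) ->
  twist * Y = cexp (\sum_k xi k * w k) *: (Y * twist).
Proof.
move=> h; apply: melP => m' m; rewrite melZ (mel_diagonal_l diagonal_twist).
rewrite (mel_diagonal_r diagonal_twist) mulrA.
have [->|Y0] := eqVneq (mel Y m' m) 0; first by rewrite !mulr0.
congr (_ * _); rewrite /twist_eig -cexpD; congr cexp; rewrite -big_split /=.
apply: eq_bigr => k _; rewrite (diagonal_weight (dF k) (h k) Y0).
by rewrite mulrDr addrC.
Qed.

(** Each additional quantum multiplies the eigenvalue of the twist by a number
    of modulus less than 1, so the eigenvalues decay geometrically in the
    degree. *)
Lemma trace_class_twist (w : osc r -> 'I_r -> C) :
  (forall p k, comm (F k) (creation R p) = w p k *: creation R p) ->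
  (forall p, complex.Re (\sum_k xi k * w p k) < 0) -> trace_class twist.
Proof.
move=> hw neg.
have [s [s0 s1 hs]] : exists s : R, [/\ 0 < s, s < 1 &
    forall p, expR (complex.Re (\sum_k xi k * w p k)) <= s ^+ 2].
  (* A ratio for all oscillators at once; its square root is needed because the
     degree is counted in both indices of the matrix. *)
  pose f p := expR (complex.Re (\sum_k xi k * w p k)).
  pose u := \big[Num.max/(2^-1 : R)]_p f p.
  have u0 : 0 < u.
    apply: (@lt_le_trans _ _ 2^-1); first by rewrite invr_gt0.
    exact: bigmax_ge_id.
  have u1 : u < 1.
    apply/bigmax_ltP; split; first by rewrite invf_lt1 // ltr1n.
    by move=> p _; rewrite /f expR_lt1.
  exists (Num.sqrt u); rewrite sqrtr_gt0 sqr_sqrtr ?(ltW u0) //; split=> //.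
    by rewrite -sqrtr1 ltr_sqrt.
  by move=> p; exact: (le_bigmax _ f p).
have hm n (m : M) : mdeg m = n ->
    `|twist_eig m| <= `|twist_eig mnm0| * ((s ^+ 2) ^+ n)%:C.
  elim: n m => [m /eqP|n IH m mn].
    by rewrite mdeg_eq0 => /eqP->; rewrite expr0 mulr1.
  have [i [m0 m'n]] := mdegS_ex mn.
  pose p := enum_val i; pose m' := mnm_sub m (mnm1 i).
  have e : twist_eig m = cexp (\sum_k xi k * w p k) * twist_eig m'.
    have := congr1 (fun Y => mel Y m m') (twist_comm (hw p)).
    rewrite melZ (mel_diagonal_l diagonal_twist).
    rewrite (mel_diagonal_r diagonal_twist) mulrA; apply: mulIf.
    rewrite -[creation R p]mulr1 mel_creation_l enum_valK (negPf m0).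
    by rewrite /mel mcoeffX eqxx oner_eq0.
  rewrite e normrM norm_cexp exprS rmorphM mulrCA.
  by rewrite ler_pM ?normr_ge0 ?lecR ?expR_ge0 // IH.
exists (Normc.normc (twist_eig mnm0)); exists s; split=> //.
  by rewrite -lecR -[X in _ <= X]/(`|twist_eig mnm0|) normr_ge0.
move=> m' m; rewrite /mel diagonal_twist mcoeffZ mcoeffX.
case: eqP => [<-|_]; last first.
  rewrite mulr0 normr0 lecR mulr_ge0 ?exprn_ge0 ?(ltW s0) //.
  by rewrite -lecR -[X in _ <= X]/(`|twist_eig mnm0|) normr_ge0.
rewrite mulr1 (le_trans (hm _ m erefl)) // rmorphM addnn -mul2n exprM.
exact: lexx.
Qed.

End Twist.

End DiagonalOperators.

(** * Cartan operators of opposite sign vectors *)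

Section CartanOperators.
Context (R : realType) (r : nat).
Local Notation C := R[i].
Local Notation E := (endo R r).
Implicit Types (mu : {ffun 'I_r -> bool}) (t x : C).

Local Notation asym_mu mu := (asym (a_mu R mu)).
Local Notation bsym_mu mu := (bsym (abar_mu R mu)).

Definition cartan mu t k : E := gen_mu mu t (k, false) (k, true).

Lemma F_mu_cartan mu t x k :
  F_mu mu t x (lshift r k) (lshift r k) = cartan mu t k.
Proof.
rewrite /F_mu mxE.
have -> : lshift r k = entry_index (k, false) by [].
rewrite lax_mu_entry /flip /= eqxx !mxE eqxx scale1r.
by rewrite addrC addKr.
Qed.

Lemma cartanE mu t k : cartan mu t k =
  (-1) ^+ mu k *: (t%:A - \sum_m bsym_mu mu k m * asym_mu mu k m).
Proof.
rewrite /cartan gen_mu_cartan osc_gen_cartan; congr (_ *: (_ - _)).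
by apply: eq_bigr => m _; rewrite (asymC _ k).
Qed.

Lemma bsym_asymC mu k m :
  bsym_mu mu k m * asym_mu mu k m = bsym_mu mu m k * asym_mu mu m k.
Proof. by rewrite bsymC asymC. Qed.

Lemma bsym_asym_vacuum mu k m : exists c : C,
  (bsym_mu mu k m * asym_mu mu k m) (1 : fock R r) = c *: (1 : fock R r).
Proof.
wlog km : k m / (k <= m)%N => [h|].
  by case: (leqP k m) => [|/ltnW] /h //; rewrite bsym_asymC.
rewrite bsym_leq // asym_leq // /abar_mu /a_mu mulrnAl -scaler_nat.
case: (mu k); rewrite (abar_osc R km) (a_osc R km).
  exists (- (k == m).+1%:R).
  have /eqP := comm_annihilation_creation R (osc_of km) (osc_of km).
  rewrite eqxx subr_eq => /eqP h.
  rewrite mulNr h scalerN -scaleNr endoZ endoD endoM annihilation_vacuum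
    linear0 addr0.
  by [].
exists 0; rewrite endoZ endoM annihilation_vacuum linear0 scaler0 scale0r.
by [].
Qed.

Lemma cartan_vacuum mu t k : exists c : C,
  cartan mu t k (1 : fock R r) = c *: (1 : fock R r).
Proof.
have [c hc] : exists c : C,
    (\sum_m bsym_mu mu k m * asym_mu mu k m) (1 : fock R r)
    = c *: (1 : fock R r).
  elim/big_rec: _ => [|m Y _ [c hc]]; first by exists 0; rewrite scale0r.
  have [c' hc'] := bsym_asym_vacuum mu k m.
  by exists (c' + c); rewrite endoD hc hc' scalerDl.
exists ((-1) ^+ mu k * (t - c)); rewrite cartanE endoZ.
by rewrite endoD endoN endoZ hc -scalerBl scalerA.
Qed.

Definition osc_weight mu (p : osc r) k : C :=
  - ((-1) ^+ mu k * (-1) ^+ mu (val p).1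
     * (((val p).1 == k) + ((val p).2 == k))%:R).

Lemma comm_cartan_creation mu t p k :
  comm (cartan mu t k) (creation R p) = osc_weight mu p k *: creation R p.
Proof. by case: p => [[i j] ij]; exact: comm_cartan_creation_osc. Qed.

Lemma diagonal_cartan mu t : exists lam, forall k,
  diagonal (cartan mu t k) (lam k).
Proof.
have h k : exists lam, diagonal (cartan mu t k) lam.
  apply: diagonal_ind (comm_cartan_creation mu t ^~ k).
  exact: cartan_vacuum.
exists (fun k => projT1 (cid (h k))) => k.
exact: (projT2 (cid (h k))).
Qed.

Definition opp_sign mu : {ffun 'I_r -> bool} := [ffun i => ~~ mu i].

(** For one of the two sign vectors the product is [abar a], and for the other
    it is [- a abar]: their sum is minus the canonical commutator, doubled on
    the diagonal by the factor 2 in [bsym]. *)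
Lemma bsym_asym_opp_sign mu k m :
  bsym_mu mu k m * asym_mu mu k m
  + bsym_mu (opp_sign mu) k m * asym_mu (opp_sign mu) k m = - (k == m).+1%:R.
Proof.
wlog km : k m / (k <= m)%N => [h|].
  case: (leqP k m) => [|/ltnW] /h //.
  by rewrite [m == k]eq_sym bsym_asymC (bsym_asymC (opp_sign mu)).
rewrite !bsym_leq // !asym_leq // /abar_mu /a_mu !ffunE !mulrnAl -mulrnDl
  -mulNrn.
congr (_ *+ _).
have h := comm_annihilation_creation R (osc_of km) (osc_of km).
rewrite eqxx in h.
by case: (mu k); rewrite (abar_osc R km) (a_osc R km) -[X in _ = - X]h
  /comm mulNr opprB // addrC.
Qed.

(** Both Cartan operators are, up to opposite signs, the parameter minus a sum
    of [r] products.  By [bsym_asym_opp_sign] the two sums add up to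
    [- (r + 1)], and so do the parameters [t] and [- r - 1 - t]. *)
Lemma cartan_opp_sign mu t k :
  cartan (opp_sign mu) (- r%:R - 1 - t) k = cartan mu t k.
Proof.
rewrite !cartanE ffunE signrN scaleNr -scalerN; congr (_ *: _).
have : \sum_m (bsym_mu mu k m * asym_mu mu k m
    + bsym_mu (opp_sign mu) k m * asym_mu (opp_sign mu) k m) = - (r%:R + 1).
  under eq_bigr do rewrite bsym_asym_opp_sign -natr1.
  rewrite sumrN big_split /= sumr_const card_ord addrC.
  by rewrite (sum_deltar (fun=> 1)).
rewrite big_split /= addrC => /(canRL (addrK _)) ->.
rewrite opprB scalerBl -[- r%:R - 1]opprD scaleNr scalerDl scaler_nat scale1r
  opprB.
by rewrite addrC addrA subrK.
Qed.

End CartanOperators.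

(** * Twisted traces of words *)

Lemma prod_swap (K : comNzRingType) (E : algType K) (J : Type) (X : J -> E)
    (l m : J) (br : seq (K * J)) :
  comm (X l) (X m) = \sum_(p <- br) p.1 *: X p.2 ->
  forall u v, \prod_(j <- u ++ [:: l, m & v]) X j =
    \prod_(j <- u ++ [:: m, l & v]) X j
    + \sum_(p <- br) p.1 *: \prod_(j <- u ++ p.2 :: v) X j.
Proof.
move=> h u v.
have -> : \sum_(p <- br) p.1 *: \prod_(j <- u ++ p.2 :: v) X j
    = \prod_(j <- u) X j * (comm (X l) (X m) * \prod_(j <- v) X j).
  rewrite h mulr_suml mulr_sumr; apply: eq_bigr => p _.
  by rewrite big_cat big_cons /= -scalerAl -scalerAr.
rewrite !big_cat !big_cons /= -mulrDr; congr (_ * _).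
by rewrite /comm mulrBl !mulrA addrC subrK.
Qed.

Section WordBracket.
Context (K : comNzRingType) (E : algType K) (r : nat).
Local Notation letter := (('I_r * bool) * ('I_r * bool))%type.
Context (X : 'I_r * bool -> 'I_r * bool -> E).
Hypothesis comm_X : forall p q k l, comm (X p q) (X k l) = sp_bracket X p q k l.

Definition letter_bracket (l m : letter) : seq (K * letter) :=
  [:: (sform K l.2 m.1, (l.1, m.2)); (sform K l.1 m.1, (l.2, m.2));
      (sform K l.2 m.2, (l.1, m.1)); (sform K l.1 m.2, (l.2, m.1))].

Lemma word_swap (l m : letter) u v :
  \prod_(j <- u ++ [:: l, m & v]) X j.1 j.2 =
  \prod_(j <- u ++ [:: m, l & v]) X j.1 j.2
  + \sum_(p <- letter_bracket l m)
      p.1 *: \prod_(j <- u ++ p.2 :: v) X j.1 j.2.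
Proof.
apply: (@prod_swap _ _ _ (fun l => X l.1 l.2)).
by rewrite comm_X /sp_bracket /letter_bracket !big_cons big_nil /= addr0 !addrA.
Qed.

End WordBracket.

Section TransferMatrices.
Context (R : realType) (r : nat) (xi : 'I_r -> R[i]).
Local Notation C := R[i].
Local Notation E := (endo R r).
Local Notation letter := (('I_r * bool) * ('I_r * bool))%type.
Hypothesis xi_decr :
  forall i j : 'I_r, (i < j)%N -> `|cexp (xi j)| < `|cexp (xi i)|.
Hypothesis xi_gt1 : forall i : 'I_r, 1 < `|cexp (xi i)|.

Lemma Re_xi_gt0 i : 0 < complex.Re (xi i).
Proof. by have := xi_gt1 i; rewrite norm_cexp ltcR expR_gt1. Qed.

Lemma Re_xi_decr (i j : 'I_r) : (i < j)%N ->
  complex.Re (xi j) < complex.Re (xi i).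
Proof. by move=> /xi_decr; rewrite !norm_cexp ltcR ltr_expR. Qed.

Definition twist_char (l : letter) : C :=
  cexp (\sum_k xi k * (weight C k l.1 + weight C k l.2)).

Lemma sum_weight p : \sum_k xi k * weight C k p = - prime_sign C p * xi p.1.
Proof.
rewrite (bigD1 p.1) //= big1 => [|k kp]; last first.
  by rewrite /weight eq_sym (negPf kp) mul0r mulr0.
by rewrite addr0 /weight eqxx mul1r mulrC /prime_sign; case: p.2;
  rewrite /= ?expr1 ?expr0 ?opprK.
Qed.

Lemma Re_signM (b : bool) (z : C) : complex.Re ((-1) ^+ b * z) =
  (-1) ^+ b * complex.Re z.
Proof. by case: b => /=; rewrite ?expr1 ?expr0 ?mul1r // !mulN1r; case: z. Qed.

Lemma ReD (z w : C) : complex.Re (z + w) = complex.Re z + complex.Re w.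
Proof. by case: z w => ? ? [? ?]. Qed.

(** The moduli of [tau_1, ..., tau_r] and of their inverses are [2 r] distinct
    numbers, so the twist commutes with no root vector. *)
Lemma twist_char_eq1 l : twist_char l = 1 -> l.2 = flip l.1.
Proof.
case: l => [[i b] [j c]]; rewrite /twist_char /flip /=.
under eq_bigr do rewrite mulrDr.
rewrite big_split /= !sum_weight /prime_sign /= -!signrN.
move=> /(congr1 (fun z => `|z|)); rewrite norm_cexp normr1.
rewrite [X in _ = X -> _](_ : _ = (expR (0 : R))%:C); last by rewrite expR0.
move=> /complexI /expR_inj; rewrite ReD !Re_signM.
have i0 := Re_xi_gt0 i; have j0 := Re_xi_gt0 j.
have [->|ij] := eqVneq i j.
  by case: b c => [] [] //= e; exfalso; move: e; rewrite ?expr0 ?expr1; lra.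
have [lt|lt] : complex.Re (xi j) < complex.Re (xi i) \/
               complex.Re (xi i) < complex.Re (xi j).
- case: (ltngtP i j) => [/Re_xi_decr|/Re_xi_decr|/val_inj/eqP]; last first.
  + by rewrite (negPf ij).
  + by right.
  + by left.
- by case: b c => [] [] /= e; exfalso; move: e; rewrite ?expr0 ?expr1; lra.
- by case: b c => [] [] /= e; exfalso; move: e; rewrite ?expr0 ?expr1; lra.
Qed.

(** The sum is [- (xi i + xi j)] or [- (xi i - xi j)] for the oscillator
    [(i, j)] with [i < j], and [- 2 xi i] for [i = j]. *)
Lemma osc_weight_lt0 (mu : {ffun 'I_r -> bool}) p :
  complex.Re (\sum_k xi k * osc_weight R mu p k) < 0.
Proof.
case: p => [[i j] ij]; rewrite /osc_weight /=.
have -> : \sum_k xi k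
      * - ((-1) ^+ mu k * (-1) ^+ mu i * ((i == k) + (j == k))%:R)
    = - (xi i + (-1) ^+ (mu i (+) mu j) * xi j).
  under eq_bigr do rewrite natrD mulrDr mulrN mulrDr.
  rewrite sumrN big_split /=; congr (- (_ + _)).
    rewrite (bigD1 i) //= eqxx mulr1 -expr2 sqrr_sign mulr1 big1 ?addr0 // => k.
    by rewrite eq_sym => /negPf->; rewrite !mulr0.
  rewrite (bigD1 j) //= eqxx mulr1 big1 ?addr0 => [|k].
    by rewrite -signr_addb addbC mulrC.
  by rewrite eq_sym => /negPf->; rewrite !mulr0.
have ReN (z : C) : complex.Re (- z) = - complex.Re z by case: z.
rewrite ReN ReD Re_signM oppr_lt0.
have i0 := Re_xi_gt0 i; have j0 := Re_xi_gt0 j.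
move: ij; rewrite /= leq_eqVlt => /orP[/eqP/val_inj<-|/Re_xi_decr].
  by rewrite addbb expr0; lra.
by case: (_ (+) _) => /=; rewrite ?expr0 ?expr1; lra.
Qed.

Section OneSignVector.
Variables (mu : {ffun 'I_r -> bool}) (t x : C).

Definition twist_mu : E := twist xi (cartan mu t).
Definition word (w : seq letter) : E := \prod_(l <- w) gen_mu mu t l.1 l.2.
Definition lax_word (w : seq letter) : E :=
  \prod_(l <- w) lax_mu mu t x (entry_index l.1) (entry_index l.2).
Definition twisted_trace (X : E) : C := fock_tr (twist_mu * X).

Lemma cyclic_word w : cyclic (word w).
Proof. by apply: cyclic_prod => l; exact: cyclic_gen_mu. Qed.

Lemma cyclic_lax_word w : cyclic (lax_word w).
Proof.
apply: cyclic_prod => l; rewrite lax_mu_entry; apply: cyclicD.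
  by apply/cyclicMn/cyclicZ; exact: cyclic1.
by apply: cyclicZ; exact: cyclic_gen_mu.
Qed.

Lemma trace_class_twist_mu : trace_class twist_mu.
Proof.
have [lam dlam] := diagonal_cartan mu t.
apply: (trace_class_twist dlam (w := osc_weight R mu)) => [p k|p].
  exact: comm_cartan_creation.
exact: osc_weight_lt0.
Qed.

Lemma trace_class_twistM X : cyclic X -> trace_class (twist_mu * X).
Proof. by move=> /(_ _ trace_class_twist_mu)[]. Qed.

Lemma twisted_traceD X Y : cyclic X -> cyclic Y ->
  twisted_trace (X + Y) = twisted_trace X + twisted_trace Y.
Proof.
by move=> cX cY; rewrite /twisted_trace mulrDr fock_trD //;
  exact: trace_class_twistM.
Qed.

Lemma twisted_traceZ a X : cyclic X ->
  twisted_trace (a *: X) = a * twisted_trace X.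
Proof.
by move=> cX; rewrite /twisted_trace -scalerAr fock_trZ //;
  exact: trace_class_twistM.
Qed.

Lemma twisted_trace_cyclic l w :
  twisted_trace (word (l :: w))
  = twist_char l * twisted_trace (word (rcons w l)).
Proof.
have [lam dlam] := diagonal_cartan mu t.
rewrite /twisted_trace /word big_cons -cats1 big_cat big_seq1 /=.
pose wl k := weight C k l.1 + weight C k l.2.
rewrite mulrA /twist_mu (twist_comm xi dlam (w := wl)).
  have tr := trace_class_twistM (cyclic_word w).
  have [tl _ e] := cyclic_gen_mu mu t l.1 l.2 tr.
  rewrite -scalerAl -mulrA fock_trZ //.
  by rewrite e -mulrA.
by move=> k; exact: comm_cartan_gen_mu.
Qed.

Lemma twisted_trace_sum (I : Type) (l : seq I) (c : I -> C) (Y : I -> E) :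
  (forall i, cyclic (Y i)) -> twisted_trace (\sum_(i <- l) c i *: Y i)
  = \sum_(i <- l) c i * twisted_trace (Y i).
Proof.
move=> cY; elim: l => [|i l IH].
  rewrite !big_nil -(scale0r (1 : E)) twisted_traceZ ?mul0r //; exact: cyclic1.
rewrite !big_cons twisted_traceD ?twisted_traceZ ?IH //; first exact: cyclicZ.
by apply: cyclic_sum => k _; exact: cyclicZ.
Qed.

Lemma twisted_trace_swap u l m v :
  twisted_trace (word (u ++ [:: l, m & v])) =
  twisted_trace (word (u ++ [:: m, l & v]))
  + \sum_(p <- letter_bracket C l m) p.1 * twisted_trace (word (u ++ p.2 :: v)).
Proof.
have -> : word (u ++ [:: l, m & v]) = word (u ++ [:: m, l & v])
    + \sum_(p <- letter_bracket C l m) p.1 *: word (u ++ p.2 :: v).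
  exact: (word_swap (comm_gen_mu mu t)).
rewrite twisted_traceD; [|exact: cyclic_word|]; last first.
  by apply: cyclic_sum => p _; apply: cyclicZ; exact: cyclic_word.
by rewrite twisted_trace_sum // => p; exact: cyclic_word.
Qed.

End OneSignVector.

(** The difference of both sides satisfies the hypotheses of
    [twisted_trace_eq0], with the same brackets and characters for the two
    realizations; on words in Cartan letters the two operators coincide. *)
Lemma twisted_trace_word_opp_sign mu t w :
  twisted_trace mu t (word mu t w)
  = twisted_trace (opp_sign mu) (- r%:R - 1 - t)
      (word (opp_sign mu) (- r%:R - 1 - t) w).
Proof.
apply/eqP; rewrite -subr_eq0; apply/eqP; move: w.
apply: (twisted_trace_eq0 (chi := twist_char) (br := letter_bracket C (r:=r)))
  => [u l m v|l w|w].
- rewrite (twisted_trace_swap mu t u l m v).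
  rewrite (twisted_trace_swap (opp_sign mu) _ u l m v).
  rewrite opprD addrACA -sumrB; congr (_ + _).
  by apply: eq_bigr => p _; rewrite mulrBr.
- by rewrite (twisted_trace_cyclic mu) (twisted_trace_cyclic (opp_sign mu))
  mulrBr.
move=> /allP diag.
have -> : word (opp_sign mu) (- r%:R - 1 - t) w = word mu t w.
  apply: eq_big_seq => l /diag /eqP /twist_char_eq1; case: l => [[i b] q] /= ->.
  have hc := cartan_opp_sign mu t i.
  by case: b; rewrite /flip /= ?[gen_mu _ _ (i, true) _]gen_muC.
rewrite /twisted_trace (_ : twist_mu _ _ = twist_mu mu t) ?subrr //.
by apply: eq_bigr => k _; rewrite cartan_opp_sign.
Qed.

(** Each entry of the Lax matrix is a multiple of the identity plus a generator;
    the word [u] collects the generators from the expanded entries. *)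
Lemma twisted_trace_lax_opp_sign mu t x u v :
  twisted_trace mu t (word mu t u * lax_word mu t x v)
  = twisted_trace (opp_sign mu) (- r%:R - 1 - t)
      (word (opp_sign mu) (- r%:R - 1 - t) u
       * lax_word (opp_sign mu) (- r%:R - 1 - t) x v).
Proof.
elim: v u => [|l v IH] u.
  have nilE nu s : word nu s u * lax_word nu s x [::] = word nu s u.
    by rewrite [lax_word nu s x [::]]big_nil (mulr1 (word nu s u)).
  by rewrite (nilE mu t) (nilE (opp_sign mu));
    exact: twisted_trace_word_opp_sign.
have step nu s : twisted_trace nu s (word nu s u * lax_word nu s x (l :: v))
    = x *+ (l.1 == l.2) * twisted_trace nu s (word nu s u * lax_word nu s x v)
    + prime_sign C l.2 * twisted_trace nu s
        (word nu s (rcons u (l.1, flip l.2)) * lax_word nu s x v).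
  have cu := cyclicM (cyclic_word nu s u) (cyclic_lax_word nu s x v).
  have cl := cyclicM (cyclic_word nu s (rcons u (l.1, flip l.2)))
    (cyclic_lax_word nu s x v).
  rewrite -!twisted_traceZ // -twisted_traceD; try exact: cyclicZ.
  congr twisted_trace.
  rewrite {1}/lax_word big_cons lax_mu_entry -/(lax_word nu s x v).
  rewrite mulrDl mulrDr scalerMnl -2!scalerAl mul1r -2!scalerAr;
    congr (_ + _ *: _).
  by rewrite {2}/word -cats1 big_cat big_seq1 /= mulrA.
by rewrite !step !IH.
Qed.

(** The entries of a tensor power are products of entries of the factors, at
    positions that do not depend on the matrix: this allows comparing the two
    Lax matrices entry by entry. *)
Lemma ntensmx_word N (p q : 'I_((r + r) ^ N)) : exists w : seq letter,
  forall L : 'M[E]_(r + r), (L ^t N) p q =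
    \prod_(l <- w) L (entry_index l.1) (entry_index l.2).
Proof.
case: N p q => [|N] p q.
  exists [::] => L; rewrite big_nil ntensmx0 mxE.
  by move: p q => [[|//] ?] [[|//] ?].
elim: N p q => [|N IH] p q.
  by exists [:: (@label r p, @label r q)] => L; rewrite big_seq1 !labelK.
have [w hw] := IH (mxtens_unindex p).2 (mxtens_unindex q).2.
exists ((label (mxtens_unindex p).1, label (mxtens_unindex q).1) :: w) => L.
by rewrite ntensmxSS mxE hw big_cons !labelK.
Qed.

Lemma Tplus_opp_sign N mu t x :
  Tplus N xi mu t x = Tplus N xi (opp_sign mu) (- r%:R - 1 - t) x.
Proof.
apply/matrixP => p q; have [w hw] := ntensmx_word p q.
have trE nu s : Tplus N xi nu s x p q = twisted_trace nu s (lax_word nu s x w).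
  rewrite /Tplus mxE hw.
  by rewrite (eq_bigr _
    (fun k _ => f_equal (tau_pow (xi k)) (F_mu_cartan nu s x k))).
apply: etrans (trE mu t) _.
apply: etrans _ (esym (trE (opp_sign mu) (- r%:R - 1 - t))).
have nilE nu s : word nu s [::] * lax_word nu s x w = lax_word nu s x w.
  by rewrite [word nu s [::]]big_nil (mul1r (lax_word nu s x w)).
have := twisted_trace_lax_opp_sign mu t x [::] w.
by rewrite (nilE mu t) (nilE (opp_sign mu)).
Qed.

Lemma ell_opp_sign (mu : {ffun 'I_r -> bool}) :
  (ell mu + ell (opp_sign mu))%N = (r * r.+1)./2.
Proof.
have -> : (ell mu + ell (opp_sign mu))%N = (\sum_(i < r) (r - i))%N.
  rewrite [RHS](bigID mu); congr addn.
  by apply: eq_bigl => i; rewrite ffunE.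
rewrite (reindex_inj rev_ord_inj) /=.
under eq_bigr do rewrite subKn //.
rewrite mulnC -[X in (X * _)./2]/r.+1 -(bin2 r.+1) -bin2_sum big_mkord
  big_ord_recl.
by rewrite add0n; apply: eq_bigr.
Qed.

Lemma opp_signK : involutive (@opp_sign r).
Proof. by move=> mu; apply/ffunP => i; rewrite !ffunE negbK. Qed.

End TransferMatrices.

Theorem proposition5p59 (R : realType) (r N : nat) (xi : 'I_r -> R[i])
    (hr : (1 <= r)%N)
    (hdec : forall i j : 'I_r, (i < j)%N -> `|cexp (xi j)| < `|cexp (xi i)|)
    (hgt1 : forall i : 'I_r, 1 < `|cexp (xi i)|)
    (t x : R[i]) :
  transfer N xi t x
  = (-1) ^+ (r * r.+1)./2 *: transfer N xi (- r%:R - 1 - t) x.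
Proof.
rewrite /transfer scaler_sumr (reindex_inj (inv_inj (@opp_signK r))) /=.
apply: eq_bigr => mu _.
have := Tplus_opp_sign hdec hgt1 N mu (- r%:R - 1 - t) x.
rewrite subKr => <-; move: (Tplus N xi mu (- r%:R - 1 - t) x) => T.
rewrite scalerA; congr (_ *: T).
by rewrite -(ell_opp_sign mu) exprD mulrAC -expr2 sqrr_sign mul1r.
Qed.
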